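(* Let $R\to S$ be a homomorphism of local rings such that the flat dimension of $S$ as an $R$-module is finite. Then the following hold. (1) If $S$ satisfies (SAC), then $R$ satisfies (SAC). (2) If $S$ satisfies (ARC), then $R$ satisfies (ARC).
   Context: All rings are commutative Noetherian with identity. A homomorphism of local rings $(R,\mathfrak m)\to(S,\mathfrak n)$ is a ring homomorphism with $\mathfrak m S\subseteq\mathfrak n$. A ring $R$ satisfies (SAC) if for each finitely generated $R$-module $M$: whenever $\mathrm{Ext}_R^i(M,R)=0$ for all $i>0$ and $\mathrm{Ext}_R^i(M,M)=0$ for all sufficiently large $i$, one has $\mathrm{Ext}_R^i(M,M)=0$ for all $i>0$. A ring $R$ satisfies (ARC) if for each finitely generated $R$-module $M$: whenever $\mathrm{Ext}_R^i(M,M\oplus R)=0$ for all $i>0$, the module $M$ is projective. *)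

(* Defs.v *)
From HB Require Import structures.
From mathcomp Require Import all_boot all_algebra.
From mathcomp Require Import boolp classical_sets.

Set Implicit Arguments.
Unset Strict Implicit.
Unset Printing Implicit Defensive.

Import GRing.Theory.
Local Open Scope ring_scope.
Local Open Scope classical_set_scope.
Local Open Scope quotient_scope.

(* Ideals are classical sets: the ideals of ring_quotient.v are proper by
   definition, whereas the whole ring has to be allowed here. *)
Definition is_ideal (R : comNzRingType) (I : set R) : Prop :=
  [/\ I 0, forall x y, I x -> I y -> I (x + y) & forall a x, I x -> I (a * x)].

Definition ideal_span (R : comNzRingType) (A : set R) : set R :=
  smallest (@is_ideal R) A.

Definition noetherian (R : comNzRingType) : Prop :=
  forall I : set R, is_ideal I -> exists s : seq R, I = ideal_span [set` s].

Definition maximal_ideal (R : comNzRingType) (m : set R) : Prop :=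
  [/\ is_ideal m, m <> setT &
      forall J : set R, is_ideal J -> m `<=` J -> J = m \/ J = setT].

(* (R, m) is a local ring; local rings are Noetherian by convention. *)
Definition is_local_ring (R : comNzRingType) (m : set R) : Prop :=
  [/\ noetherian R, maximal_ideal m &
      forall m' : set R, maximal_ideal m' -> m' = m].

Definition is_local_hom (R S : comNzRingType) (phi : {rmorphism R -> S})
    (m : set R) (n : set S) : Prop :=
  ideal_span (phi @` m) `<=` n.

(* M regarded as an R-module through phi. *)
Definition restrict_scalars (R S : comNzRingType) (phi : {rmorphism R -> S})
  (M : lmodType S) : Type := M.

Section RestrictScalars.
Variables (R S : comNzRingType) (phi : {rmorphism R -> S}) (M : lmodType S).
Local Notation rM := (restrict_scalars phi M).

HB.instance Definition _ := GRing.Zmodule.copy rM M.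

Definition restrict_scale (a : R) (x : rM) : rM := phi a *: (x : M).

Fact restrict_scaleA a b x :
  restrict_scale a (restrict_scale b x) = restrict_scale (a * b) x.
Proof. by rewrite /restrict_scale scalerA rmorphM. Qed.

Fact restrict_scale1 : left_id 1 restrict_scale.
Proof. by move=> x; rewrite /restrict_scale rmorph1 scale1r. Qed.

Fact restrict_scaleDr : right_distributive restrict_scale +%R.
Proof. by move=> a x y; rewrite /restrict_scale scalerDr. Qed.

Fact restrict_scaleDl x : {morph restrict_scale^~ x : a b / a + b}.
Proof. by move=> a b; rewrite /restrict_scale rmorphD scalerDl. Qed.

HB.instance Definition _ := GRing.Zmodule_isLmodule.Build R rM
  restrict_scaleA restrict_scale1 restrict_scaleDr restrict_scaleDl.

End RestrictScalars.

Definition finitely_generated (R : comNzRingType) (M : lmodType R) : Prop :=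
  exists (n : nat) (v : 'I_n -> M),
    forall x : M, exists c : 'I_n -> R, x = \sum_(i < n) c i *: v i.

Definition projective (R : comNzRingType) (P : lmodType R) : Prop :=
  forall (A B : lmodType R) (g : {linear A -> B}) (f : {linear P -> B}),
    (forall b, exists a, g a = b) ->
    exists h : {linear P -> A}, forall x, g (h x) = f x.

Definition exact (R : comNzRingType) (A B C : lmodType R)
    (f : {linear A -> B}) (g : {linear B -> C}) : Prop :=
  forall y, g y = 0 <-> exists x, f x = y.

(* The tensor product of M and N: formal sums of pairs, two of them being
   identified when every bilinear map on M x N takes the same value on both. *)
Section Tensor.
Variables (R : comNzRingType) (M N : lmodType R).
Implicit Types (x y : seq (M * N)) (W : lmodType R).

Definition bisum W (b : M -> N -> W) x : W := \sum_(p <- x) b p.1 p.2.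

Definition tensor_rel x y : bool :=
  `[< forall W (b : {bilinear M -> N -> W}), bisum b x = bisum b y >].

Fact tensor_rel_refl : reflexive tensor_rel.
Proof. by move=> x; apply/asboolP. Qed.

Fact tensor_rel_sym : symmetric tensor_rel.
Proof. by move=> x y; apply/asboolP/asboolP => h W b; rewrite h. Qed.

Fact tensor_rel_trans : transitive tensor_rel.
Proof.
move=> y x z /asboolP xy /asboolP yz.
by apply/asboolP => W b; rewrite xy yz.
Qed.

Canonical tensor_equiv :=
  EquivRel tensor_rel tensor_rel_refl tensor_rel_sym tensor_rel_trans.

Definition tensor := {eq_quot tensor_equiv}.

HB.instance Definition _ := Choice.on tensor.
HB.instance Definition _ := EqQuotient.on tensor.

Definition pure (u : M) (v : N) : tensor := \pi_tensor [:: (u, v)].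

Definition tensor_eval W (b : M -> N -> W) (t : tensor) : W := bisum b (repr t).

Lemma tensor_eval_pi W (b : {bilinear M -> N -> W}) x :
  tensor_eval b (\pi_tensor x) = bisum b x.
Proof.
rewrite /tensor_eval; have /eqquotP/asboolP := reprK (\pi_tensor x); exact.
Qed.

Lemma tensor_ext (s t : tensor) :
  (forall W (b : {bilinear M -> N -> W}), tensor_eval b s = tensor_eval b t) ->
  s = t.
Proof.
move=> h; rewrite -[s]reprK -[t]reprK.
by apply/eqmodP/asboolP => W b; exact: h.
Qed.

Definition tensor_zero : tensor := \pi_tensor [::].
Definition tensor_add (s t : tensor) : tensor := \pi_tensor (repr s ++ repr t).
Definition tensor_scale (a : R) (t : tensor) : tensor :=
  \pi_tensor [seq (a *: p.1, p.2) | p <- repr t].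
Definition tensor_opp (t : tensor) : tensor := tensor_scale (-1) t.

Section Eval.
Variables (W : lmodType R) (b : {bilinear M -> N -> W}).

Lemma tensor_eval0 : tensor_eval b tensor_zero = 0.
Proof. by rewrite tensor_eval_pi /bisum big_nil. Qed.

Lemma tensor_evalD s t :
  tensor_eval b (tensor_add s t) = tensor_eval b s + tensor_eval b t.
Proof. by rewrite tensor_eval_pi /bisum big_cat. Qed.

Lemma tensor_evalZ a t :
  tensor_eval b (tensor_scale a t) = a *: tensor_eval b t.
Proof.
rewrite tensor_eval_pi /tensor_eval /bisum big_map scaler_sumr.
by apply: eq_bigr => p _; rewrite linearZl_LR.
Qed.

Lemma tensor_evalN t : tensor_eval b (tensor_opp t) = - tensor_eval b t.
Proof. by rewrite tensor_evalZ scaleN1r. Qed.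

Lemma tensor_eval_pure u v : tensor_eval b (pure u v) = b u v.
Proof. by rewrite tensor_eval_pi /bisum big_seq1. Qed.

End Eval.

Definition tensor_evalE :=
  (tensor_eval0, tensor_evalD, tensor_evalN, tensor_evalZ, tensor_eval_pure).

Fact tensor_addA : associative tensor_add.
Proof. by move=> s t u; apply: tensor_ext => W b; rewrite !tensor_evalE addrA. Qed.
Fact tensor_addC : commutative tensor_add.
Proof. by move=> s t; apply: tensor_ext => W b; rewrite !tensor_evalE addrC. Qed.
Fact tensor_add0 : left_id tensor_zero tensor_add.
Proof. by move=> s; apply: tensor_ext => W b; rewrite !tensor_evalE add0r. Qed.
Fact tensor_addN : left_inverse tensor_zero tensor_opp tensor_add.
Proof. by move=> s; apply: tensor_ext => W b; rewrite !tensor_evalE addNr. Qed.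

HB.instance Definition _ := GRing.isZmodule.Build tensor
  tensor_addA tensor_addC tensor_add0 tensor_addN.

Fact tensor_scaleA a c t :
  tensor_scale a (tensor_scale c t) = tensor_scale (a * c) t.
Proof. by apply: tensor_ext => W b; rewrite !tensor_evalE scalerA. Qed.
Fact tensor_scale1 : left_id 1 tensor_scale.
Proof. by move=> t; apply: tensor_ext => W b; rewrite !tensor_evalE scale1r. Qed.
Fact tensor_scaleDr : right_distributive tensor_scale +%R.
Proof. by move=> a s t; apply: tensor_ext => W b; rewrite !tensor_evalE scalerDr. Qed.
Fact tensor_scaleDl t : {morph tensor_scale^~ t : a c / a + c}.
Proof. by move=> a c; apply: tensor_ext => W b; rewrite !tensor_evalE scalerDl. Qed.

HB.instance Definition _ := GRing.Zmodule_isLmodule.Build R tensor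
  tensor_scaleA tensor_scale1 tensor_scaleDr tensor_scaleDl.

Fact pure_bilinear : bilinear_for *:%R *:%R pure.
Proof.
by split=> [v a u u'|u a v v']; apply: tensor_ext => W b;
  rewrite !tensor_evalE ?linearPl ?linearPr.
Qed.

HB.instance Definition _ :=
  bilinear_isBilinear.Build R M N tensor *:%R *:%R pure pure_bilinear.

Section Lift.
Variables (W : lmodType R) (b : {bilinear M -> N -> W}).

Definition tensor_lift (t : tensor) : W := tensor_eval b t.

Fact tensor_lift_linear : linear tensor_lift.
Proof. by move=> a s t; rewrite /tensor_lift !tensor_evalE. Qed.

HB.instance Definition _ := GRing.isLinear.Build R tensor W *:%R tensor_lift
  tensor_lift_linear.

Lemma tensor_lift_pure u v : tensor_lift (pure u v) = b u v.
Proof. exact: tensor_eval_pure. Qed.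

Lemma tensor_lift_unique (h : {linear tensor -> W}) :
  (forall u v, h (pure u v) = b u v) -> h =1 tensor_lift.
Proof.
move=> hb t; have -> : t = \sum_(p <- repr t) pure p.1 p.2.
  apply: tensor_ext => V c; rewrite /tensor_eval -[LHS]/(bisum c _).
  have sumE s : tensor_eval c (\sum_(p <- s) pure p.1 p.2) = bisum c s.
    elim: s => [|p s IH]; first by rewrite big_nil tensor_eval0 /bisum big_nil.
    by rewrite big_cons tensor_evalD IH tensor_eval_pure /bisum big_cons.
  by rewrite -[RHS]/(tensor_eval c _) sumE.
rewrite !linear_sum; apply: eq_bigr => p _.
by rewrite hb; symmetry; exact: tensor_lift_pure.
Qed.

End Lift.
End Tensor.

Section TensorMap.
Variables (R : comNzRingType) (M N N' : lmodType R) (g : {linear N -> N'}).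

Definition pure_comp (u : M) (v : N) : tensor M N' := pure u (g v).

Fact pure_comp_bilinear : bilinear_for *:%R *:%R pure_comp.
Proof.
split=> [v a u u'|u a v v']; rewrite /pure_comp ?linearP ?linearPl //.
by rewrite linearPr.
Qed.

HB.instance Definition _ :=
  bilinear_isBilinear.Build R M N (tensor M N') *:%R *:%R pure_comp
    pure_comp_bilinear.

Definition tensor_map : {linear tensor M N -> tensor M N'} :=
  tensor_lift pure_comp.

Lemma tensor_map_pure u v : tensor_map (pure u v) = pure u (g v).
Proof. exact: tensor_lift_pure. Qed.

End TensorMap.

Definition flat (R : comNzRingType) (F : lmodType R) : Prop :=
  forall (A B C : lmodType R) (f : {linear A -> B}) (g : {linear B -> C}),
    exact f g -> exact (tensor_map F f) (tensor_map F g).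

Record resolution (R : comNzRingType) (M : lmodType R) := Resolution {
  res_obj :> nat -> lmodType R;
  res_diff : forall i, {linear res_obj i.+1 -> res_obj i};
  res_aug : {linear res_obj 0 -> M};
  res_aug_surj : forall x, exists y, res_aug y = x;
  res_exact0 : exact (res_diff 0) res_aug;
  res_exact : forall i, exact (res_diff i.+1) (res_diff i)
}.

Definition flat_dim_le (R : comNzRingType) (M : lmodType R) (n : nat) : Prop :=
  exists F : resolution M,
    (forall i, flat (F i)) /\ forall i, (n < i)%N -> forall x : F i, x = 0.

Definition finite_flat_dim (R : comNzRingType) (M : lmodType R) : Prop :=
  exists n : nat, flat_dim_le M n.

Section ExtVanishing.
Variables (R : comNzRingType) (M N : lmodType R).

Definition cocycle (P : resolution M) i (f : {linear P i -> N}) : Prop :=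
  forall x, f (res_diff P i x) = 0.

Definition coboundary (P : resolution M) i : {linear P i -> N} -> Prop :=
  match i with
  | 0 => fun f => forall x, f x = 0
  | j.+1 => fun f => exists g : {linear P j -> N},
                       forall x, f x = g (res_diff P j x)
  end.

(* Ext^i_R(M, N) = 0, i.e. H^i(Hom_R(P, N)) = 0 for a projective resolution P
   of M; this does not depend on P. *)
Definition Ext_eq0 (i : nat) : Prop :=
  exists P : resolution M, (forall j, projective (P j)) /\
    forall f : {linear P i -> N}, cocycle f -> coboundary f.

End ExtVanishing.

Definition SAC (R : comNzRingType) : Prop :=
  forall M : lmodType R, finitely_generated M ->
    (forall i, (0 < i)%N -> Ext_eq0 M R^o i) ->
    (exists n, forall i, (n <= i)%N -> Ext_eq0 M M i) ->
    forall i, (0 < i)%N -> Ext_eq0 M M i.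

Definition ARC (R : comNzRingType) : Prop :=
  forall M : lmodType R, finitely_generated M ->
    (forall i, (0 < i)%N -> Ext_eq0 M (M * R^o)%type i) ->
    projective M.

(* Main.v *)
(* Let M be a finitely generated R-module with Ext_R^i(M, R) = 0 for i > 0.
   Dimension shifting gives Ext_R^i(M, M) = Ext_R^i(M', M') for every syzygy M'
   of M and i > 0, and a syzygy M' of order at least fd_R S satisfies
   Tor_i^R(M', S) = 0 for i > 0, so that Ext_S^i(M' (x) S, M' (x) S) is
   Ext_R^i(M', M' (x) S).  Shifting along the finite flat resolution of S, if
   Ext_R^i(M', M') = 0 for all i > t then Ext_R^i(M', M' (x) S) = 0 for all
   i > t, and Ext_R^t(M', M' (x) S) = Ext_R^t(M', M') (x) S vanishes only if
   Ext_R^t(M', M') does, by Nakayama's lemma.  For (SAC) one descends on t; for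
   (ARC) the same step is applied to Ext^1(M', Omega M'), whose vanishing splits
   the resolution.

   Modules enter through matrices: with A_t the differentials of a resolution
   by free modules of finite rank, Ext^(t+1)(coker A_0, coker B) = 0 says that
   A_(t+1) F = G B implies F = A_t H + K B. *)
Require Import Defs.
From HB Require Import structures.
From mathcomp Require Import all_boot all_algebra.
From mathcomp Require Import boolp classical_sets.

Set Implicit Arguments.
Unset Strict Implicit.
Unset Printing Implicit Defensive.

Import GRing.Theory.
Local Open Scope ring_scope.
Local Open Scope classical_set_scope.

(** * Row vectors with entries in a module *)

Section Vmul.
Variables (R : comNzRingType) (V : lmodType R).

(** Under V (x) R^p = V^p this is the map induced by [B] on V (x) R^p, obtained without forming a
    tensor product. *)
Definition vmul p q (x : 'rV[V]_p) (B : 'M[R]_(p, q)) : 'rV[V]_q :=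
  \row_k \sum_j B j k *: x 0 j.

Lemma vmulA p q r (x : 'rV_p) (B : 'M_(p, q)) (C : 'M_(q, r)) :
  vmul (vmul x B) C = vmul x (B *m C).
Proof.
apply/rowP => k; rewrite !mxE.
under eq_bigr do rewrite mxE scaler_sumr.
rewrite exchange_big /=; apply: eq_bigr => j _.
rewrite mxE scaler_suml; apply: eq_bigr => i _.
by rewrite scalerA mulrC.
Qed.

Lemma vmulBl p q (x y : 'rV_p) (B : 'M_(p, q)) :
  vmul (x - y) B = vmul x B - vmul y B.
Proof.
apply/rowP => k; rewrite !mxE -sumrB; apply: eq_bigr => j _.
by rewrite !mxE scalerBr.
Qed.

Lemma vmulDl p q (x y : 'rV_p) (B : 'M_(p, q)) :
  vmul (x + y) B = vmul x B + vmul y B.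
Proof.
apply/rowP => k; rewrite !mxE -big_split; apply: eq_bigr => j _.
by rewrite !mxE scalerDr.
Qed.

Lemma vmulNl p q (x : 'rV_p) (B : 'M_(p, q)) : vmul (- x) B = - vmul x B.
Proof.
by apply/rowP => k; rewrite !mxE -sumrN; apply: eq_bigr => j _; rewrite !mxE scalerN.
Qed.

Lemma vmul0l p q (B : 'M_(p, q)) : vmul 0 B = 0.
Proof. by apply/rowP => k; rewrite !mxE big1 // => j _; rewrite mxE scaler0. Qed.

Lemma vmul0r p q (x : 'rV_p) : vmul x (0 : 'M_(p, q)) = 0.
Proof. by apply/rowP => k; rewrite !mxE big1 // => j _; rewrite mxE scale0r. Qed.

Lemma vmulDr p q (x : 'rV_p) (B C : 'M_(p, q)) :
  vmul x (B + C) = vmul x B + vmul x C.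
Proof.
apply/rowP => k; rewrite !mxE -big_split; apply: eq_bigr => j _.
by rewrite !mxE scalerDl.
Qed.

Lemma vmulNr p q (x : 'rV_p) (B : 'M_(p, q)) : vmul x (- B) = - vmul x B.
Proof.
by apply/rowP => k; rewrite !mxE -sumrN; apply: eq_bigr => j _; rewrite !mxE scaleNr.
Qed.

Lemma vmul_row_mx p q r (x : 'rV_p) (B : 'M_(p, q)) (C : 'M_(p, r)) :
  vmul x (row_mx B C) = row_mx (vmul x B) (vmul x C).
Proof.
apply/rowP => k; rewrite !mxE; case: splitP => i ki; rewrite mxE;
  apply: eq_bigr => j _; congr (_ *: _).
  by rewrite -(row_mxEl B C); congr (row_mx _ _ _ _); apply: val_inj.
by rewrite -(row_mxEr B C); congr (row_mx _ _ _ _); apply: val_inj.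
Qed.

Lemma vmul_col_mx p q r (x : 'rV_p) (y : 'rV_q) (B : 'M_(p, r)) (C : 'M_(q, r)) :
  vmul (row_mx x y) (col_mx B C) = vmul x B + vmul y C.
Proof.
apply/rowP => k; rewrite !mxE big_split_ord /=; congr (_ + _);
  by apply: eq_bigr => i _; rewrite ?col_mxEu ?row_mxEl ?col_mxEd ?row_mxEr.
Qed.

End Vmul.

Lemma map_vmul (R : comNzRingType) (V W : lmodType R) (f : {linear V -> W})
    p q (x : 'rV[V]_p) (B : 'M[R]_(p, q)) :
  map_mx f (vmul x B) = vmul (map_mx f x) B.
Proof.
apply/rowP => k; rewrite !mxE linear_sum; apply: eq_bigr => j _.
by rewrite mxE linearZ.
Qed.

Definition mxexact (R : comNzRingType) p q r (X : 'M[R]_(p, q)) (Y : 'M_(q, r)) :=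
  forall x : 'rV_q, x *m Y = 0 <-> exists y, x = y *m X.

Lemma mxexact0 (R : comNzRingType) p q r (X : 'M[R]_(p, q)) (Y : 'M_(q, r)) :
  mxexact X Y -> X *m Y = 0.
Proof.
move=> XY; apply/row_matrixP => i; rewrite row_mul row0.
by apply/XY; exists (delta_mx 0 i); rewrite -rowE.
Qed.

Lemma mxexact_lift (R : comNzRingType) p q r s (X : 'M[R]_(p, q)) (Y : 'M_(q, r))
    (Z : 'M_(s, q)) :
  mxexact X Y -> Z *m Y = 0 -> exists U, Z = U *m X.
Proof.
move=> XY ZY.
have /choice[u uP] : forall i, exists y, row i Z = y *m X.
  by move=> i; apply/XY; rewrite -row_mul ZY row0.
exists (\matrix_i u i); apply/row_matrixP => i.
by rewrite row_mul rowK.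
Qed.

Section Coordinate.
Variables (R : comNzRingType) (V : lmodType R) (n : nat) (j : 'I_n).

(** Lifted to the tensor product, this is the j-th component of V (x) R^n = V^n. *)
Definition coordinate (u : V) (v : 'rV[R]_n) : V := v 0 j *: u.

Fact coordinate_bilinear : bilinear_for *:%R *:%R coordinate.
Proof.
split=> [v a u u1|u a v v1] /=; rewrite /coordinate.
  by rewrite scalerDr !scalerA [v 0 j * a]mulrC.
by rewrite !mxE scalerDl scalerA.
Qed.

HB.instance Definition _ :=
  bilinear_isBilinear.Build R V 'rV[R]_n V *:%R *:%R coordinate coordinate_bilinear.

End Coordinate.

Lemma tensor_sum (R : comNzRingType) (M N : lmodType R) (t : tensor M N) :
  t = \sum_(p <- generic_quotient.repr t) pure p.1 p.2.
Proof.
apply: tensor_ext => V c; rewrite -[tensor_eval c _]/(tensor_lift c _).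
rewrite -[RHS]/(tensor_lift c _) linear_sum /=.
by apply: eq_bigr => p _; rewrite [RHS]tensor_lift_pure.
Qed.

(** The identification F (x) R^q = F^q turns the tensor exactness in [flat] into exactness for
    [vmul]. *)
Lemma flat_mxexact (R : comNzRingType) (F : lmodType R) p q r
    (X : 'M[R]_(p, q)) (Y : 'M_(q, r)) (x : 'rV[F]_q) :
  flat F -> mxexact X Y -> vmul x Y = 0 -> exists y, x = vmul y X.
Proof.
move=> flF XY xY0.
have ex : exact (mulmxr X : {linear 'rV_p -> 'rV_q}) (mulmxr Y : {linear 'rV_q -> 'rV_r}).
  move=> y; split=> [/XY[z ->]|[z <-]]; first by exists z.
  by apply/XY; exists z.
(* The tensor with coordinates [x]. Expanding the rows of [Y] in the standard basis, its image has
   the coordinates of [vmul x Y], which are zero. *)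
pose t : tensor F 'rV[R]_q := \sum_j pure (x 0 j) (delta_mx 0 j).
have /(flF _ _ _ _ _ ex)[s st] : tensor_map F (mulmxr Y) t = 0.
  rewrite linear_sum /=.
  under eq_bigr => j _.
    rewrite tensor_map_pure /= -rowE (row_sum_delta (row j Y)) linear_sumr.
    under eq_bigr => k _ do rewrite linearZr_LR /= -linearZl_LR /= mxE.
    over.
  rewrite exchange_big big1 //= => k _; rewrite -linear_sumlz /=.
  by move/rowP/(_ k): xY0; rewrite !mxE => ->; rewrite linear0l.
exists (\row_i tensor_lift (@coordinate R F p i) s); apply/rowP => k.
have <- : tensor_lift (@coordinate R F q k) t = x 0 k.
  rewrite linear_sum (bigD1 k) //= tensor_lift_pure big1 ?addr0 => [|i ik].
    by rewrite /= /coordinate mxE !eqxx scale1r.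
  by rewrite tensor_lift_pure /= /coordinate mxE eq_sym (negPf ik) andbF scale0r.
rewrite -st mxE; have [L ->] : exists L : seq (F * 'rV[R]_p),
    s = \sum_(i <- L) pure i.1 i.2 by exists (generic_quotient.repr s); exact: tensor_sum.
rewrite [tensor_map _ _ _]linear_sum [LHS]linear_sum.
under [RHS]eq_bigr do rewrite mxE [tensor_lift _ _]linear_sum scaler_sumr.
rewrite exchange_big; apply: eq_bigr => -[u v] _.
rewrite [tensor_map _ _ _]tensor_map_pure [LHS]tensor_lift_pure /= /coordinate mxE scaler_suml.
by apply: eq_bigr => i _; rewrite [tensor_lift _ _]tensor_lift_pure /= scalerA mulrC.
Qed.

(** * Complexes of matrices with coefficients of finite flat dimension *)

Lemma map_mx_exact (R : comNzRingType) (A B C : lmodType R) (f : {linear A -> B})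
    (g : {linear B -> C}) p q (y : 'M[B]_(p, q)) :
  exact f g -> map_mx g y = 0 -> exists x, map_mx f x = y.
Proof.
move=> fg /matrixP gy0.
have /choice[x xP] : forall ij : 'I_p * 'I_q, exists a, f a = y ij.1 ij.2.
  by move=> [i j]; apply/fg; have := gy0 i j; rewrite !mxE.
by exists (\matrix_(i, j) x (i, j)); apply/matrixP => i j; rewrite !mxE xP.
Qed.

Lemma map_mx_exact0 (R : comNzRingType) (A B C : lmodType R) (f : {linear A -> B})
    (g : {linear B -> C}) p q (x : 'M[A]_(p, q)) :
  exact f g -> map_mx g (map_mx f x) = 0.
Proof. by move=> fg; apply/matrixP => i j; rewrite !mxE; apply/fg; exists (x i j). Qed.

(* [flat_ladder i f] makes the image of [f] a module of flat dimension less
   than [i]; working with [F] modulo the kernel of [f] avoids submodules. *)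
Inductive flat_ladder (R : comNzRingType) :
    nat -> forall F W : lmodType R, {linear F -> W} -> Prop :=
| flat_ladder0 (F W : lmodType R) (f : {linear F -> W}) :
    (forall x : F, x = 0) -> flat_ladder 0 f
| flat_ladderS i (F' F W : lmodType R) (g : {linear F' -> F}) (f : {linear F -> W}) :
    flat F -> exact g f -> flat_ladder i g -> flat_ladder i.+1 f.

(** The ladder is climbed from the zero module in degree n + 1 down to degree 0, one rung for each
    of the n + 1 terms that may be nonzero. *)
Lemma flat_ladder_aug (R : comNzRingType) (M : lmodType R) n (F : resolution M) :
    (forall i, flat (F i)) -> (forall i, (n < i)%N -> forall x : F i, x = 0) ->
  flat_ladder n.+1 (res_aug F).
Proof.
move=> flF F0; apply: flat_ladderS (flF 0) (@res_exact0 _ _ F) _.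
have diff k : (k <= n)%N -> flat_ladder k (res_diff F (n - k)).
  elim: k => [_|k IH kn]; first by rewrite subn0; apply: flat_ladder0; exact: F0.
  apply: flat_ladderS (flF _) (@res_exact _ _ F _) _.
  by rewrite subnSK //; apply: IH; exact: ltnW.
by have := diff n (leqnn n); rewrite subnn.
Qed.

Section Tor.
Variables (R : comNzRingType) (c : nat -> nat) (b : forall k, 'M[R]_(c k.+1, c k)).
Hypothesis b_exact : forall k, mxexact (b k.+1) (b k).

(** Equality after applying [f] is equality in im f, so this is Tor_(k+1)(coker b_0, im f) = 0 for a
    resolution [b]. *)
Definition tor_vanish (V W : lmodType R) (f : {linear V -> W}) k :=
  forall x : 'rV[V]_(c k.+1), map_mx f (vmul x (b k)) = 0 ->
    exists y, map_mx f (x - vmul y (b k.+1)) = 0.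

(** Each rung is a sequence 0 -> im g -> F -> im f -> 0 with F flat, whence Tor_(k+2) with im f
    reduces to Tor_(k+1) with im g. *)
Lemma flat_ladder_tor i (V W : lmodType R) (f : {linear V -> W}) k :
  flat_ladder i f -> (i <= k)%N -> tor_vanish f k.
Proof.
move=> fl; elim: fl k => {i V W f} [F W f F0|i F' F W g f flF gf _ IH] k ik x fxb.
  exists 0; rewrite vmul0l subr0; apply/matrixP => p q.
  by rewrite !mxE [x p q]F0 linear0.
case: k ik x fxb => // k ik x /(map_mx_exact gf)[z gz].
have /(IH _ ik)[y /eqP] : map_mx g (vmul z (b k)) = 0.
  by rewrite map_vmul gz vmulA (mxexact0 (@b_exact k)) vmul0r.
rewrite map_mxB subr_eq0 gz map_vmul => /eqP xy.
have /(flat_mxexact flF (@b_exact k.+1))[v xv] :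
    vmul (x - map_mx g y) (b k.+1) = 0 by rewrite vmulBl xy subrr.
by exists v; rewrite -xv opprB addrC subrK map_mx_exact0.
Qed.

End Tor.

(* Row vectors indexed by [e k t] are the maps from the [t]-th term of a
   resolution to the [k]-th term of another one. *)
Section Bicomplex.
Variables (R : comNzRingType) (e : nat -> nat -> nat).
Variables (a : forall k t, 'M[R]_(e k t, e k t.+1)).
Variables (b : forall k t, 'M[R]_(e k.+1 t, e k t)).
Hypothesis ab : forall k t, a k.+1 t *m b k t.+1 = b k t *m a k t.
Hypothesis aa : forall k t, a k t *m a k t.+1 = 0.
Hypothesis bb : forall k t, b k.+1 t *m b k t = 0.
Hypothesis noethR : forall p q (Y : 'M[R]_(p, q)), exists r (X : 'M_(r, p)), mxexact X Y.
Variables (j D : nat).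
Hypothesis torb : forall i (V W : lmodType R) (f : {linear V -> W}) t,
  flat_ladder i f -> (i <= D)%N -> tor_vanish (fun k => b k t) f j.

(** The same condition for the target (coker b_j) (x) im f: [F] lifts a cochain, and [G] witnesses
    that its coboundary vanishes there. *)
Definition ext_vanish (V W : lmodType R) (f : {linear V -> W}) t :=
  forall (F : 'rV[V]_(e j t.+1)) (G : 'rV[V]_(e j.+1 t.+2)),
    map_mx f (vmul F (a j t.+1) - vmul G (b j t.+2)) = 0 ->
    exists H K, map_mx f (F - vmul H (a j t) - vmul K (b j t.+1)) = 0.

Definition ext_vanish_mx t :=
  forall (F : 'rV[R]_(e j t.+1)) (G : 'rV[R]_(e j.+1 t.+2)),
    F *m a j t.+1 = G *m b j t.+2 ->
    exists H K, F = H *m a j t + K *m b j t.+1.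

Section Generators.
Variables (t z : nat) (Zl : 'M[R]_(z, e j t.+1)) (Zr : 'M[R]_(z, e j.+1 t.+2)).
(** The rows of [Zl] generate the cocycles over R, and those of [Zr] are their witnesses. *)
Hypothesis Z_exact : mxexact (row_mx Zl Zr) (col_mx (a j t.+1) (- b j t.+2)).

Lemma cocycle_gens : Zl *m a j t.+1 = Zr *m b j t.+2.
Proof.
apply/eqP; rewrite -subr_eq0 -mulmxN -mul_row_col.
by apply/eqP; exact: mxexact0.
Qed.

Lemma cocycle_gensP (F : 'rV[R]_(e j t.+1)) (G : 'rV[R]_(e j.+1 t.+2)) :
  F *m a j t.+1 = G *m b j t.+2 -> exists w, F = w *m Zl.
Proof.
move=> FG; have /Z_exact[w] : row_mx F G *m col_mx (a j t.+1) (- b j t.+2) = 0.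
  by rewrite mul_row_col mulmxN FG subrr.
by rewrite mul_mx_row => /eq_row_mx[-> _]; exists w.
Qed.

(** Cocycles with coefficients in im f come from Z (x) im f, where Z is the module of cocycles over
    R. *)
Definition cocycle_lift (V W : lmodType R) (f : {linear V -> W}) :=
  forall (F : 'rV[V]_(e j t.+1)) (G : 'rV[V]_(e j.+1 t.+2)),
    map_mx f (vmul F (a j t.+1) - vmul G (b j t.+2)) = 0 ->
    exists w, map_mx f (F - vmul w Zl) = 0.

(** The connecting map of 0 -> im g -> V -> im f -> 0 sends a cocycle over im f to a class one
    degree higher over im g. That class vanishes, so the cocycle can be corrected to one over V,
    where flatness applies. *)
Lemma ext_vanish_cocycle_lift i (V' V W : lmodType R) (g : {linear V' -> V})
    (f : {linear V -> W}) :
    flat V -> exact g f -> flat_ladder i.+1 f -> (i < D)%N ->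
  ext_vanish g t.+1 -> cocycle_lift f.
Proof.
move=> flV gf lad iD extg F G /(map_mx_exact gf)[C gC].
(* The failure [C] of [F] to be a cocycle over V needs its own witness: vanishing of Tor writes
   [vmul G (a j.+1 t.+2)] as a boundary plus an element [G'] of the previous rung. *)
have /torb : flat_ladder i.+1 f by [].
move=> /(_ t.+3 iD (vmul G (a j.+1 t.+2)))[|L /(map_mx_exact gf)[G' gG']].
  rewrite vmulA ab -vmulA.
  have -> : vmul (vmul G (b j t.+2)) (a j t.+2) = vmul (- map_mx g C) (a j t.+2).
    by rewrite gC opprB vmulBl [vmul (vmul F _) _]vmulA aa vmul0r subr0.
  by rewrite -map_mxN -map_vmul map_mx_exact0.
have [|H [K /eqP gHK]] := extg C (- G').
  rewrite vmulNl opprK map_mxD !map_vmul gC gG' vmulBl [vmul (_ - _) (b _ _)]vmulBl.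
  by rewrite !vmulA ab aa bb !vmul0r subr0 sub0r addNr.
have : vmul (row_mx (F - map_mx g H) (G + map_mx g K))
    (col_mx (a j t.+1) (- b j t.+2)) = 0.
  rewrite vmul_col_mx vmulNr vmulBl vmulDl opprD addrACA -gC.
  by move: gHK; rewrite !map_mxB !map_vmul addrA => /eqP.
case/(flat_mxexact flV Z_exact) => w; rewrite vmul_row_mx => /eq_row_mx[FH _].
by exists w; rewrite -FH opprB addrC subrK map_mx_exact0.
Qed.

(** Each generating cocycle is a coboundary over R, hence so is every combination with coefficients
    in V. *)
Lemma cocycle_lift_ext_vanish (V W : lmodType R) (f : {linear V -> W}) :
  ext_vanish_mx t -> cocycle_lift f -> ext_vanish f t.
Proof.
move=> extR liftf F G /liftf[w fw].
have /choice[HK HKP] : forall i, exists HK, row i Zl =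
    HK.1 *m a j t + HK.2 *m b j t.+1.
  move=> i; have [|H [K ->]] := extR (row i Zl) (row i Zr).
    by rewrite -!row_mul cocycle_gens.
  by exists (H, K).
exists (vmul w (\matrix_i (HK i).1)), (vmul w (\matrix_i (HK i).2)).
rewrite -addrA -opprD !vmulA -vmulDr -[RHS]fw; congr (map_mx _ (_ - vmul _ _)).
by apply/row_matrixP => i; rewrite linearD /= !row_mul !rowK -HKP.
Qed.

(** Injectivity of Z (x) im f into the cochains, the companion of [cocycle_lift]. A relation over im
    f yields a cocycle [C] over im g; lifting [C] by generators corrects [w] to a genuine relation
    over the flat module. *)
Lemma cocycle_relations i (V W : lmodType R) (f : {linear V -> W})
    r (Y : 'M_(r, z)) (w : 'rV[V]_z) :
    mxexact Y Zl -> flat_ladder i f -> (i <= D)%N ->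
    (forall i' (V' W' : lmodType R) (g : {linear V' -> W'}),
       flat_ladder i' g -> (i' <= D)%N -> cocycle_lift g) ->
    map_mx f (vmul w Zl) = 0 ->
  exists v, map_mx f (w - vmul v Y) = 0.
Proof.
move=> YZ lad; case: (lad) w => {i V W f lad} [F W f F0|i F' F W g f flF gf lad] w iD lift.
  move=> _; exists 0; rewrite vmul0l subr0; apply/matrixP => p q.
  by rewrite !mxE [w p q]F0 linear0.
have ladf := flat_ladderS flF gf lad.
move=> fwZ; have /torb : flat_ladder i.+1 f by [].
move=> /(_ t.+2 iD (vmul w Zr))[|L /(map_mx_exact gf)[G' gG']].
  by rewrite vmulA -cocycle_gens -vmulA map_vmul fwZ vmul0l.
have [C gC] := map_mx_exact gf fwZ.
have [||w' /eqP] := lift _ _ _ _ lad _ C G'; first exact: ltnW.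
  rewrite map_mxB !map_vmul gC gG' vmulBl !vmulA bb vmul0r subr0 cocycle_gens.
  exact: subrr.
rewrite map_mxB map_vmul gC -vmulBl => /eqP /(flat_mxexact flF YZ)[v wv].
by exists v; rewrite -wv opprB addrC subrK map_mx_exact0.
Qed.

End Generators.

Lemma gens_exists t : exists z (Zl : 'M[R]_(z, e j t.+1)) (Zr : 'M_(z, e j.+1 t.+2)),
  mxexact (row_mx Zl Zr) (col_mx (a j t.+1) (- b j t.+2)).
Proof.
have [z [Z ZP]] := noethR (col_mx (a j t.+1) (- b j t.+2)).
by exists z, (lsubmx Z), (rsubmx Z); rewrite hsubmxK.
Qed.

(** Induction along the ladder: degree t for im f uses degree t + 1 for im g. *)
Lemma flat_ladder_ext i (V W : lmodType R) (f : {linear V -> W}) t :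
  flat_ladder i f -> (i <= D)%N -> (forall s, (t <= s)%N -> ext_vanish_mx s) ->
  ext_vanish f t.
Proof.
move=> fl; elim: fl t => {i V W f} [F W f F0|i F' F W g f flF gf lad IH] t iD extR.
  move=> x y _; exists 0, 0; apply/matrixP => p q.
  by rewrite !vmul0l !subr0 !mxE [x p q]F0 linear0.
have [z [Zl [Zr ZP]]] := gens_exists t.
apply: (cocycle_lift_ext_vanish ZP (extR _ _)) => //.
apply: (ext_vanish_cocycle_lift ZP flF gf (flat_ladderS flF gf lad)) => //.
by apply: IH; [exact: ltnW|move=> s /ltnW; exact: extR].
Qed.

(** The obstruction to lifting lies one degree higher, so only vanishing strictly above t enters;
    this is what lets t descend. *)
Lemma flat_ladder_cocycle_lift t z (Zl : 'M[R]_(z, e j t.+1)) (Zr : 'M_(z, e j.+1 t.+2))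
    i (V W : lmodType R) (f : {linear V -> W}) :
    mxexact (row_mx Zl Zr) (col_mx (a j t.+1) (- b j t.+2)) ->
    (forall s, (t < s)%N -> ext_vanish_mx s) ->
  flat_ladder i f -> (i <= D)%N -> cocycle_lift Zl f.
Proof.
move=> ZP extR; case => {i V W f} [F W f F0|i F' F W g f flF gf lad] iD.
  move=> x y _; exists 0; apply/matrixP => p q.
  by rewrite !vmul0l !subr0 !mxE [x p q]F0 linear0.
apply: (ext_vanish_cocycle_lift ZP flF gf (flat_ladderS flF gf lad)) => //.
exact: (flat_ladder_ext lad (ltnW iD)).
Qed.

End Bicomplex.

(** * Noetherian and local rings *)

Lemma ideal_span_seq (R : comNzRingType) (s : seq R) a :
  ideal_span [set` s] a ->
  exists c : 'I_(size s) -> R, a = \sum_(i < size s) c i * s`_i.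
Proof.
move=> /(_ [set a | exists c : 'I_(size s) -> R, a = \sum_(i < size s) c i * s`_i]).
apply; split=> [|x /= /(nthP 0)[i ilt <-]]; last first.
  exists (fun j => ((j : nat) == i)%:R); rewrite (bigD1 (Ordinal ilt)) //= eqxx mul1r.
  by rewrite big1 ?addr0 // => j; rewrite -val_eqE /= => /negPf->; rewrite mul0r.
split=> [|x y [c ->] [d ->]|x y [c ->]].
- by exists (fun=> 0); rewrite big1 // => i _; rewrite mul0r.
- exists (fun i => c i + d i); rewrite -big_split; apply: eq_bigr => i _.
  by rewrite mulrDl.
- exists (fun i => x * c i); rewrite mulr_sumr; apply: eq_bigr => i _.
  by rewrite mulrA.
Qed.

(** Induction on q: generators of the ideal of first entries are lifted to [K], and the elements of
    [K] with first entry 0 form a submodule of R^(q-1). *)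
Lemma noetherian_row_span (R : comNzRingType) q (K : set 'rV[R]_q) :
    noetherian R -> K 0 -> (forall x y, K x -> K y -> K (x + y)) ->
    (forall a x, K x -> K (a *: x)) ->
  exists r (X : 'M_(r, q)), forall x, K x <-> exists y, x = y *m X.
Proof.
move=> noeth; elim: q K => [|q IH]; last rewrite -[q.+1]/(1 + q)%N => K K0 KD KZ.
  move=> K K0 KD KZ; exists 0, 0 => x; split=> _; last by rewrite [x]thinmx0.
  by exists 0; rewrite [x]thinmx0 mul0mx.
pose I := [set a : R | exists x : 'rV_q, K (row_mx (a%:M : 'M_1) x)].
have Iideal : is_ideal I.
  split=> [|a b [x Kx] [y Ky]|a b [x Kx]].
  - by exists 0; rewrite raddf0 row_mx0.
  - by exists (x + y); rewrite raddfD /= -add_row_mx; exact: KD.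
  - by exists (a *: x); rewrite -scale_scalar_mx -scale_row_mx; exact: KZ.
have [s sI] := noeth I Iideal.
have Is i : (i < size s)%N -> I s`_i.
  by move=> ilt; rewrite sI => J [_]; apply; rewrite /= mem_nth.
have /choice[x xP] : forall i : 'I_(size s),
  exists x : 'rV_q, K (row_mx ((s`_i)%:M : 'M_1) x) by move=> i; exact: Is.
have [] := IH [set x | K (row_mx (0 : 'M_1) x)].
- by rewrite /= row_mx0.
- by move=> y z Ky Kz; have := KD _ _ Ky Kz; rewrite add_row_mx addr0.
- by move=> a y Ky; have := KZ a _ Ky; rewrite scale_row_mx scaler0.
move=> r [X XP].
pose X1 : 'M[R]_(size s, 1 + q) := \matrix_i row_mx ((s`_i)%:M : 'M_1) (x i).
have KX1 c : K (c *m X1).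
  rewrite mulmx_sum_row; elim/big_ind: _ => // i _.
  by rewrite rowK; apply: KZ; exact: xP.
exists (size s + r)%N, (col_mx X1 (row_mx (0 : 'M_(r, 1)) X)) => y; split.
  rewrite -{1 2}[y]hsubmxK => Ky.
  have : I (lsubmx y 0 0) by exists (rsubmx y); rewrite -mx11_scalar.
  rewrite sI => /ideal_span_seq[c yc].
  (* Subtracting lifted generators clears the first entry. *)
  pose z := y - (\row_i c i) *m X1.
  have z0 : lsubmx z = 0.
    apply/rowP => k; rewrite [k]ord1 /z linearB /= !mxE; move: yc; rewrite !mxE => ->.
    apply/eqP; rewrite subr_eq0; apply/eqP; apply: eq_bigr => i _.
    by rewrite !mxE; case: splitP => // k' _; rewrite [k']ord1 !mxE.
  have : K (row_mx 0 (rsubmx z)).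
    rewrite -z0 hsubmxK /z; apply: KD; first by rewrite -[y]hsubmxK.
    by rewrite -scaleN1r; exact/KZ/KX1.
  case/(XP (rsubmx z)) => w zw; exists (row_mx (\row_i c i) w).
  by rewrite mul_row_col mul_mx_row mulmx0 -zw -z0 !hsubmxK [RHS]addrC subrK.
case=> c ->; rewrite -[c]hsubmxK mul_row_col; apply: KD => //.
by rewrite mul_mx_row mulmx0; apply/(XP (rsubmx c *m X)); exists (rsubmx c).
Qed.

Lemma noetherian_mxexact (R : comNzRingType) p q (Y : 'M[R]_(p, q)) :
  noetherian R -> exists r (X : 'M_(r, p)), mxexact X Y.
Proof.
move=> noeth; apply: (noetherian_row_span (K := [set x | x *m Y = 0])) => //=.
- by rewrite mul0mx.
- by move=> x z xY zY; rewrite mulmxDl xY zY addr0.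
- by move=> c x xY; rewrite -scalemxAl xY scaler0.
Qed.

Lemma setT_ideal (R : comNzRingType) (I : set R) :
  is_ideal I -> I 1 -> I = setT.
Proof.
by case=> _ _ IZ I1; apply/seteqP; split=> // x _; rewrite -[x]mulr1; exact: IZ.
Qed.

(* Noetherian rings satisfy the ascending chain condition, so that an ideal
   without a maximal ideal above it would give a strictly ascending chain. *)
Lemma maximal_ideal_exists (R : comNzRingType) (I : set R) :
  noetherian R -> is_ideal I -> I <> setT ->
  exists2 m, maximal_ideal m & I `<=` m.
Proof.
move=> noeth idI IT; apply: contrapT => nomax.
pose T := {J : set R | is_ideal J /\ J <> setT /\ I `<=` J}.
have /choice[next nextP] : forall J : T, exists J' : T,
    sval J `<=` sval J' /\ sval J' <> sval J.
  case=> J [idJ [JT IJ]] /=; apply: contrapT => noJ'; apply: nomax.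
  exists J => //; split=> // J' idJ' JJ'.
  have [->|J'T] := pselect (J' = setT); [by right|left].
  apply: contrapT => J'J; apply: noJ'.
  have IJ' := subset_trans IJ JJ'.
  by exists (exist _ J' (conj idJ' (conj J'T IJ'))).
pose c k := iter k next (exist _ I (conj idI (conj IT (@subset_refl _ I))) : T).
have c_mono k l : (k <= l)%N -> sval (c k) `<=` sval (c l).
  move=> /subnKC <-; elim: (l - k)%N => [|d IH]; first by rewrite addn0.
  by rewrite addnS; apply: subset_trans IH _; exact: (nextP _).1.
pose U := \bigcup_k sval (c k).
have idU : is_ideal U.
  split=> [|x y [k _ cx] [l _ cy]|a x [k _ cx]].
  - by exists 0%N => //=; have [] := idI.
  - exists (maxn k l) => //; have [[_ cD _] _] := svalP (c (maxn k l)).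
    by apply: cD; [exact: (c_mono _ _ (leq_maxl _ _))|exact: (c_mono _ _ (leq_maxr _ _))].
  - by exists k => //; have [[_ _ cZ] _] := svalP (c k); exact: cZ.
have [s Us] := noeth U idU.
have [k sk] : exists k, [set` s] `<=` sval (c k).
  have : [set` s] `<=` U by rewrite Us => x sx J [_]; exact.
  elim: {Us} s => [|x s IH] sU; first by exists 0%N.
  have [k sk] := IH (fun y ys => sU y (mem_behead (s := x :: s) ys)).
  have [l _ cx] := sU x (mem_head x s).
  exists (maxn k l) => y /=; rewrite inE => /orP[/eqP->|ys].
    exact: (c_mono _ _ (leq_maxr _ _)).
  exact/(c_mono _ _ (leq_maxl _ _))/sk.
have [_] := nextP (c k); apply; apply/seteqP; split; last exact: (c_mono _ _ (leqnSn k)).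
apply: (@subset_trans _ U); first by move=> x cx; exists k.+1.
by rewrite Us => x; apply; split=> //; have [] := svalP (c k).
Qed.

Lemma local_ring_unit (R : comNzRingType) (m : set R) x :
  is_local_ring m -> ~ m x -> exists y, y * x = 1.
Proof.
move=> [noeth _ uniq] mx; apply: contrapT => nunit; apply: mx.
have idx : is_ideal [set y * x | y in setT].
  split=> [|_ _ [y _ <-] [z _ <-]|a _ [y _ <-]].
  - by exists 0 => //; rewrite mul0r.
  - by exists (y + z) => //; rewrite mulrDl.
  - by exists (a * y) => //; rewrite mulrA.
have [|m' maxm' xm'] := maximal_ideal_exists noeth idx.
  move=> xT; have [y _ yx] : [set y * x | y in setT] 1 by rewrite xT.
  by apply: nunit; exists y.
by rewrite -(uniq _ maxm'); apply: xm'; exists 1 => //; rewrite mul1r.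
Qed.

(* Nakayama's lemma: the columns are eliminated one by one, each of them
   having an entry outside [m], since [phi] maps [m] into [n]. *)
Lemma local_left_inverse (R S : comNzRingType) (phi : {rmorphism R -> S})
    (m : set R) (n : set S) p q (Q : 'M[R]_(q, p)) (V : 'M[S]_(p, q)) :
    is_local_ring m -> is_local_ring n -> is_local_hom phi m n ->
  V *m map_mx phi Q = 1%:M -> exists U : 'M_(p, q), U *m Q = 1%:M.
Proof.
move=> locR locS hphi; elim: p Q V => [|p IH] Q V VQ.
  by exists 0; rewrite [LHS]flatmx0 [RHS]flatmx0.
have phim x : m x -> n (phi x).
  by move=> mx; apply: hphi => J [_]; apply; exists x.
have [n0 nD nZ] : is_ideal n by case: locS => _ [].
move: Q V VQ; rewrite -[p.+1]/(1 + p)%N => Q V.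
rewrite -[Q]hsubmxK -[V]vsubmxK; set c := lsubmx Q; set Q' := rsubmx Q.
set v := usubmx V; set V' := dsubmx V.
rewrite map_row_mx mul_col_row scalar_mx_block => /eq_block_mx[vc _ V'c V'Q'].
(* Were all entries of [c] in m, the entry 1 of the product of [v] and the image of [c] would lie in
   n. *)
have [i mi] : exists i, ~ m (c i 0).
  apply: contrapT => all_m; have nT : n <> setT by case: locS => _ [].
  apply/nT/setT_ideal; first by split.
  have <- : (v *m map_mx phi c) 0 0 = 1 by rewrite vc mxE.
  rewrite mxE; elim/big_ind: _ => // j _; rewrite [map_mx _ _ _ _]mxE; apply: nZ.
  by apply: phim; apply: contrapT => ci; apply: all_m; exists j.
have [y yc] := local_ring_unit locR mi.
pose u : 'rV[R]_q := y *: delta_mx 0 i.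
have uc : u *m c = 1%:M.
  by apply/rowP => k; rewrite [k]ord1 -scalemxAl -rowE [LHS]mxE [row _ _ _ _]mxE yc !mxE.
(* Since [u *m c = 1], the matrix [1 - c *m u] annihilates [c]; since [V'] annihilates the image of
   [c], it remains a left inverse after this projection. *)
have [U2 U2P] : exists U2 : 'M_(p, q), U2 *m ((1%:M - c *m u) *m Q') = 1%:M.
  apply: (IH _ V').
  by rewrite mulmxBl mul1mx map_mxB mulmxBr V'Q' !map_mxM !mulmxA V'c !mul0mx subr0.
pose U' := U2 *m (1%:M - c *m u).
have U'c : U' *m c = 0 by rewrite -mulmxA mulmxBl mul1mx -mulmxA uc mulmx1 subrr mulmx0.
have U'Q' : U' *m Q' = 1%:M by rewrite -mulmxA.
clearbody U'.
(* The correction term makes the first row annihilate [Q'] and keeps its product with [c]. *)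
exists (col_mx (u - u *m Q' *m U') U').
rewrite mul_col_row !mulmxBl uc -!mulmxA U'c U'Q' !mulmx0 mulmx1 subr0 subrr.
by rewrite -scalar_mx_block.
Qed.

(** * Resolutions and Ext *)

Section Kernel.
Variables (R : comNzRingType) (A B : lmodType R) (f : {linear A -> B}).

Definition kernel_pred : {pred A} := fun x => f x == 0.

Fact kernel_submod_closed : submod_closed kernel_pred.
Proof.
split=> [|a x y]; rewrite ?inE /in_mem /= /kernel_pred ?linear0 ?eqxx //.
by move=> /eqP fx /eqP fy; rewrite linearP fx fy scaler0 addr0.
Qed.

HB.instance Definition _ := GRing.isSubmodClosed.Build R A kernel_pred
  kernel_submod_closed.

Record kernel := Kernel { kernel_val : A; _ : kernel_val \in kernel_pred }.

HB.instance Definition _ := [isSub for kernel_val].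
HB.instance Definition _ := [Choice of kernel by <:].
HB.instance Definition _ := [SubChoice_isSubLmodule of kernel by <:].

Lemma kernelP (x : kernel) : f (val x) = 0.
Proof. by apply/eqP; exact: (valP x). Qed.

Definition to_kernel (C : lmodType R) (h : {linear C -> A})
  (fh : forall x, f (h x) = 0) (x : C) : kernel :=
  Kernel (introT eqP (fh x) : h x \in kernel_pred).

Fact to_kernel_linear C h fh : linear (@to_kernel C h fh).
Proof. by move=> a x y; apply: val_inj; rewrite /= linearP. Qed.

HB.instance Definition _ C h fh := GRing.isLinear.Build R C kernel *:%R
  (@to_kernel C h fh) (to_kernel_linear fh).

End Kernel.

(** Here [g] only has to reach the image of [f]: projectivity is applied to the pullback of [f] and
    [g], which maps onto P. *)
Lemma projective_lift (R : comNzRingType) (P A B : lmodType R) (g : {linear A -> B})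
    (f : {linear P -> B}) :
  projective P -> (forall x, exists a, g a = f x) ->
  exists h : {linear P -> A}, forall x, g (h x) = f x.
Proof.
move=> projP gf.
pose d : {linear (P * A)%type -> B} := (f \o fst) \- (g \o snd).
have surj x : exists y : kernel d, (fst \o val) y = x.
  have [a ga] := gf x.
  have dxa : (x, a) \in kernel_pred d by apply/eqP; rewrite /= /d /= ga subrr.
  by exists (Kernel dxa).
have [h hP] := projP _ _ (fst \o val : {linear kernel d -> P}) idfun surj.
exists (snd \o val \o h) => x /=.
have /eqP := kernelP (h x); rewrite /d /= subr_eq0 => /eqP <-.
by have /= -> := hP x.
Qed.

Section Comparison.
Variables (R : comNzRingType) (M : lmodType R) (P Q : resolution M).
Hypotheses (projP : forall i, projective (P i)) (projQ : forall i, projective (Q i)).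

Lemma res_diff_diff (L : resolution M) i x :
  res_diff L i (res_diff L i.+1 x) = 0.
Proof. by apply/(@res_exact _ _ L); exists x. Qed.

(* [a] and [b] are the degree [i] parts of chain maps lifting the identity of
   [M], and [h] is that of a homotopy from [a \o b] to the identity; only their
   values on boundaries matter for the next degree. *)
Lemma comparison i : exists (a : {linear P i -> Q i}) (b : {linear Q i -> P i})
    (h : {linear Q i -> Q i.+1}),
  [/\ forall x, exists y, res_diff Q i y = a (res_diff P i x),
      forall x, exists y, res_diff P i y = b (res_diff Q i x) &
      forall x, res_diff Q i x =
        a (b (res_diff Q i x)) + res_diff Q i (h (res_diff Q i x))].
Proof.
elim: i => [|i [a [b [h [aP bP hP]]]]].
  have [a aP] := @projP 0%N _ _ _ (res_aug P) (@res_aug_surj _ _ Q).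
  have [b bP] := @projQ 0%N _ _ _ (res_aug Q) (@res_aug_surj _ _ P).
  have [x|h hP] := projective_lift (f := idfun \- (a \o b)) (g := res_diff Q 0) (@projQ 0%N).
    by apply/(@res_exact0 _ _ Q); rewrite linearB /= aP bP subrr.
  exists a, b, h; split=> x.
  - by apply/(@res_exact0 _ _ Q); rewrite aP; apply/(@res_exact0 _ _ P); exists x.
  - by apply/(@res_exact0 _ _ P); rewrite bP; apply/(@res_exact0 _ _ Q); exists x.
  - by rewrite hP /= addrC subrK.
have [a' a'P] := projective_lift (f := a \o res_diff P i) (@projP i.+1) aP.
have [b' b'P] := projective_lift (f := b \o res_diff Q i) (@projQ i.+1) bP.
(* By the third clause in degree i, [k] takes values in cycles, so it lifts to the next homotopy. *)
pose k : {linear Q i.+1 -> Q i.+1} := (idfun \- (a' \o b')) \- (h \o res_diff Q i).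
have [x|h' h'P] := projective_lift (f := k) (g := res_diff Q i.+1) (@projQ i.+1).
  apply/(@res_exact _ _ Q); rewrite /k /= !linearB /= a'P /= b'P /=.
  by rewrite {1}hP -addrA -opprD subrr.
exists a', b', h'; split=> x.
- by apply/(@res_exact _ _ Q); rewrite a'P /= res_diff_diff linear0.
- by apply/(@res_exact _ _ P); rewrite b'P /= res_diff_diff linear0.
- by rewrite h'P /k /= res_diff_diff linear0 subr0 addrC subrK.
Qed.

(** Pull [f] back along [a'] to P, bound it there by [g], and return along [b]; the homotopy
    accounts for the difference, up to a cycle, on which [f] vanishes. *)
Lemma cocycle_coboundary_transfer (N : lmodType R) i :
  (forall f : {linear P i.+1 -> N}, cocycle f -> coboundary f) ->
  forall f : {linear Q i.+1 -> N}, cocycle f -> coboundary f.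
Proof.
have [a [b [h [aP bP hP]]]] := comparison i.
move=> extP f fZ.
have [a' a'P] := projective_lift (f := a \o res_diff P i) (@projP i.+1) aP.
have [b' b'P] := projective_lift (f := b \o res_diff Q i) (@projQ i.+1) bP.
have fker x : res_diff Q i x = 0 -> f x = 0.
  by move/(@res_exact _ _ Q) => [y <-]; exact: fZ.
have [|g gP] := extP (f \o a').
  by move=> x /=; apply: fker; rewrite a'P /= res_diff_diff linear0.
exists ((g \o b) \+ (f \o h)) => x /=.
rewrite -[b _]/((b \o res_diff Q i) x) -b'P -gP /= -linearD.
apply/eqP; rewrite -subr_eq0 -linearB; apply/eqP/fker.
by rewrite linearB linearD /= a'P /= b'P /= -hP subrr.
Qed.

End Comparison.

Lemma Ext_eq0_cocycle (R : comNzRingType) (M N : lmodType R) (Q : resolution M) i :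
  (forall j, projective (Q j)) -> Ext_eq0 M N i.+1 ->
  forall f : {linear Q i.+1 -> N}, cocycle f -> coboundary f.
Proof. by move=> projQ [P [projP extP]]; exact: (cocycle_coboundary_transfer projP). Qed.


Definition pair_map (R : comNzRingType) (P N N' : lmodType R) (f : {linear P -> N})
  (g : {linear P -> N'}) (x : P) : (N * N')%type := (f x, g x).

Fact pair_map_linear (R : comNzRingType) (P N N' : lmodType R) (f : {linear P -> N})
  (g : {linear P -> N'}) : linear (pair_map f g).
Proof. by move=> a x y; rewrite /pair_map !linearP. Qed.

HB.instance Definition _ (R : comNzRingType) (P N N' : lmodType R)
    (f : {linear P -> N}) (g : {linear P -> N'}) :=
  GRing.isLinear.Build R P (N * N')%type *:%R (pair_map f g) (pair_map_linear f g).

Lemma Ext_eq0_retract (R : comNzRingType) (M N N' : lmodType R)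
    (u : {linear N -> N'}) (v : {linear N' -> N}) i :
  cancel u v -> Ext_eq0 M N' i.+1 -> Ext_eq0 M N i.+1.
Proof.
move=> uK [P [projP ext]]; exists P; split=> // f fZ.
have [x|g gP] := ext (u \o f); first by rewrite /= fZ linear0.
by exists (v \o g) => x /=; rewrite -gP /= uK.
Qed.

Lemma Ext_eq0_prod (R : comNzRingType) (M N N' : lmodType R) i :
  Ext_eq0 M (N * N')%type i.+1 <-> Ext_eq0 M N i.+1 /\ Ext_eq0 M N' i.+1.
Proof.
split=> [ext|[[P [projP extN]] extN']].
  split; first exact: (Ext_eq0_retract (u := pair_map idfun \0) (v := fst)) ext.
  exact: (Ext_eq0_retract (u := pair_map \0 idfun) (v := snd)) ext.
exists P; split=> // f fZ.
have [x|g gP] := extN (fst \o f); first by rewrite /= fZ.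
(* The two factors may come with different resolutions; the second is moved to that of the first. *)
have [x|h hP] := Ext_eq0_cocycle projP extN' (f := snd \o f); first by rewrite /= fZ.
by exists (pair_map g h) => x; rewrite /= /pair_map -gP -hP; exact: surjective_pairing.
Qed.

Section RowComb.
Variables (R : comNzRingType) (V : lmodType R) (n : nat) (v : 'I_n -> V).

Definition row_comb (x : 'rV[R]_n) : V := \sum_i x 0 i *: v i.

Fact row_comb_linear : linear row_comb.
Proof.
move=> a x y; rewrite scaler_sumr -big_split; apply: eq_bigr => i _.
by rewrite !mxE scalerDl scalerA.
Qed.

HB.instance Definition _ := GRing.isLinear.Build R 'rV[R]_n V *:%R row_comb
  row_comb_linear.

End RowComb.

Lemma linear_row_comb (R : comNzRingType) (V : lmodType R) n
    (f : {linear 'rV[R]_n -> V}) x : f x = row_comb (fun i => f (delta_mx 0 i)) x.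
Proof.
by rewrite {1}[x]row_sum_delta linear_sum; apply: eq_bigr => i _; rewrite linearZ.
Qed.

Lemma free_projective (R : comNzRingType) n : projective 'rV[R]_n.
Proof.
move=> A B g f surj.
have /choice[a aP] : forall i, exists a, g a = f (delta_mx 0 i) by move=> i; exact: surj.
exists (row_comb a) => x; rewrite [RHS]linear_row_comb linear_sum.
by apply: eq_bigr => i _; rewrite linearZ aP.
Qed.

Lemma free_lift (R : comNzRingType) p q (N : lmodType R) (e : {linear 'rV[R]_q -> N})
    (f : {linear 'rV[R]_p -> N}) :
  (forall y, exists x, e x = y) -> exists H : 'M_(p, q), forall x, f x = e (x *m H).
Proof.
move=> surj; have [h hP] := free_projective f surj.
by exists (lin1_mx h) => x; rewrite mul_rV_lin1 hP.
Qed.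

Lemma linear_factor (R : comNzRingType) (L M N : lmodType R) (e : {linear L -> M})
    (u : {linear L -> N}) :
    (forall y, exists x, e x = y) -> (forall x, e x = 0 -> u x = 0) ->
  exists h : {linear M -> N}, forall x, h (e x) = u x.
Proof.
move=> /choice[s sP] eu.
have us x y : e x = e y -> u x = u y.
  by move=> exy; apply/eqP; rewrite -subr_eq0 -linearB eu // linearB exy subrr.
have lin : linear (u \o s).
  by move=> a x y; rewrite /= -linearP; apply: us; rewrite linearP !sP.
pose hL := GRing.isLinear.Build R M N *:%R (u \o s) lin.
pose h : {linear M -> N} := HB.pack (u \o s) hL.
by exists h => x; apply: us; rewrite sP.
Qed.

Section FreeResolution.
Variables (R : comNzRingType) (M : lmodType R) (n : nat -> nat).
Variables (A : forall t, 'M[R]_(n t.+1, n t)) (aug : {linear 'rV[R]_(n 0) -> M}).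
Hypothesis aug_surj : forall x, exists y, aug y = x.
Hypothesis aug_exact : forall x, aug x = 0 <-> exists y, x = y *m A 0.
Hypothesis A_exact : forall t, mxexact (A t.+1) (A t).

Fact free_res_exact0 : exact (mulmxr (A 0) : {linear _ -> _}) aug.
Proof. by move=> x; split=> [/aug_exact[y ->]|[y <-]]; [exists y|apply/aug_exact; exists y]. Qed.

Fact free_res_exact t :
  exact (mulmxr (A t.+1) : {linear 'rV_(n t.+2) -> _})
        (mulmxr (A t) : {linear 'rV_(n t.+1) -> 'rV_(n t)}).
Proof. by move=> x; split=> [/A_exact[y ->]|[y <-]]; [exists y|apply/A_exact; exists y]. Qed.

Definition free_resolution : resolution M :=
  @Resolution R M (fun t => 'rV[R]_(n t)) (fun t => mulmxr (A t)) aug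
    aug_surj free_res_exact0 free_res_exact.

Definition mx_ext_vanish q r (B : 'M[R]_(r, q)) t :=
  forall (F : 'M_(n t.+1, q)) (G : 'M_(n t.+2, r)), A t.+1 *m F = G *m B ->
    exists H K, F = A t *m H + K *m B.

(** Maps from a free module to N lift through [e] to matrices, unique modulo products [K *m B]; the
    matrix [G] records that the coboundary of [F] is such a product. *)
Lemma Ext_mx (N : lmodType R) q r (e : {linear 'rV[R]_q -> N}) (B : 'M_(r, q)) t :
    (forall x, exists y, e y = x) -> (forall x, e x = 0 <-> exists y, x = y *m B) ->
  Ext_eq0 M N t.+1 <-> mx_ext_vanish B t.
Proof.
move=> e_surj e_exact.
have projL j : projective (free_resolution j) by exact: free_projective.
have span s (X : 'M_(s, q)) : (forall x, e (x *m X) = 0) -> exists K, X = K *m B.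
  move=> eX; have /choice[k kP] : forall i, exists y, row i X = y *m B.
    by move=> i; apply/e_exact; rewrite rowE.
  by exists (\matrix_i k i); apply/row_matrixP => i; rewrite row_mul rowK.
have eB x : e (x *m B) = 0 by apply/e_exact; exists x.
split=> [ext F G FG|ext].
  have [x|g gP] := Ext_eq0_cocycle projL ext (f := e \o mulmxr F).
    by rewrite /= -mulmxA FG mulmxA eB.
  have [H HP] := free_lift g e_surj.
  have [x|K KP] := span _ (F - A t *m H).
    by rewrite mulmxBr linearB mulmxA -HP -[g _]gP subrr.
  by exists H, K; rewrite -KP addrC subrK.
exists free_resolution; split=> // f fZ.
have [F FP] := free_lift f e_surj.
have [x|G GP] := span _ (A t.+1 *m F); first by rewrite mulmxA -FP; exact: fZ.
have [H [K HK]] := ext F G GP.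
exists (e \o mulmxr H) => x.
by rewrite FP /= HK mulmxDr linearD /= !mulmxA eB addr0.
Qed.

End FreeResolution.

Lemma Ext_ring_mx (R : comNzRingType) (M : lmodType R) (n : nat -> nat)
    (A : forall t, 'M[R]_(n t.+1, n t)) (aug : {linear 'rV[R]_(n 0) -> M}) t :
    (forall x, exists y, aug y = x) ->
    (forall x, aug x = 0 <-> exists y, x = y *m A 0) ->
    (forall t, mxexact (A t.+1) (A t)) ->
  Ext_eq0 M R^o t.+1 <-> mx_ext_vanish A (0 : 'M_(0, 1)) t.
Proof.
move=> aug_surj aug_exact A_exact.
pose e : {linear 'rV[R]_1 -> R^o} := row_comb (fun=> 1).
have eE x : e x = x 0 0 by rewrite /e /= /row_comb big_ord1 -[LHS]/(_ * 1) mulr1.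
apply: (Ext_mx aug_surj aug_exact A_exact (e := e)) => x.
  by exists (x%:M); rewrite eE mxE.
rewrite eE; split=> [x0|[y ->]]; last by rewrite mulmx0 mxE.
by exists 0; rewrite mul0mx [x]mx11_scalar x0 raddf0.
Qed.

(** * Base change *)

Lemma mxvec_ext (R : comNzRingType) p q r (X Y : 'M[R]_(p * q, r)) :
  (forall Z : 'M_(p, q), mxvec Z *m X = mxvec Z *m Y) -> X = Y.
Proof.
move=> XY; apply/row_matrixP => i; rewrite !rowE.
by rewrite -(vec_mxK (delta_mx 0 i)) XY.
Qed.

Lemma lin_mulmxr_exact (R : comNzRingType) p q r s (X : 'M[R]_(p, q)) (Y : 'M_(q, r)) :
  mxexact X Y -> mxexact (lin_mulmxr X : 'M_(s * p, _)) (lin_mulmxr Y).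
Proof.
move=> XY x; rewrite -[x]vec_mxK mul_vec_lin; split.
  move/(congr1 vec_mx); rewrite mxvecK linear0 => /(mxexact_lift XY)[U ->].
  by exists (mxvec U); rewrite mul_vec_lin.
case=> y; rewrite -[y]vec_mxK mul_vec_lin => /(can_inj mxvecK) -> /=.
by rewrite -mulmxA (mxexact0 XY) mulmx0 linear0.
Qed.

Section Bihom.
Variables (R : comNzRingType) (n : nat -> nat) (A : forall t, 'M[R]_(n t.+1, n t)).
Hypothesis A_exact : forall t, mxexact (A t.+1) (A t).
Variables (p : nat -> nat) (B : forall k, 'M[R]_(p k.+1, p k)).
Hypothesis B_exact : forall k, mxexact (B k.+1) (B k).

(** Hom(R^(n t), R^(p k)) is flattened by [mxvec], so that the bicomplex of row vectors applies. *)
Definition hom_a k t : 'M[R]_(n t * p k, n t.+1 * p k) := lin_mulmx (A t).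
Definition hom_b k t : 'M[R]_(n t * p k.+1, n t * p k) := lin_mulmxr (B k).

Lemma hom_ab k t : hom_a k.+1 t *m hom_b k t.+1 = hom_b k t *m hom_a k t.
Proof. by apply: mxvec_ext => Z; rewrite !mulmxA !mul_vec_lin /= mulmxA. Qed.

Lemma hom_aa k t : hom_a k t *m hom_a k t.+1 = 0.
Proof.
apply: mxvec_ext => Z.
by rewrite mulmxA mulmx0 !mul_vec_lin /= mulmxA (mxexact0 (@A_exact t)) mul0mx linear0.
Qed.

Lemma hom_bb k t : hom_b k.+1 t *m hom_b k t = 0.
Proof.
apply: mxvec_ext => Z.
by rewrite mulmxA !mul_vec_lin /= -mulmxA (mxexact0 (@B_exact k)) !mulmx0 linear0.
Qed.

Lemma ext_vanish_mxP j t : ext_vanish_mx hom_a hom_b j t <-> mx_ext_vanish A (B j) t.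
Proof.
split=> ext F G.
  move/(congr1 mxvec) => FG; have := ext (mxvec F) (mxvec G).
  rewrite !mul_vec_lin => /(_ FG)[H [K]].
  rewrite -[H]vec_mxK -[K]vec_mxK !mul_vec_lin -linearD => /(can_inj mxvecK) -> /=.
  by exists (vec_mx H), (vec_mx K).
rewrite -[F]vec_mxK -[G]vec_mxK !mul_vec_lin => /(can_inj mxvecK) /ext[H [K ->]].
by exists (mxvec H), (mxvec K); rewrite !mul_vec_lin -linearD.
Qed.

End Bihom.

Lemma vmul_restrict (R S : comNzRingType) (phi : {rmorphism R -> S}) p q
    (x : 'rV[restrict_scalars phi S^o]_p) (Y : 'M[R]_(p, q)) :
  vmul x Y = (x : 'rV[S]_p) *m map_mx phi Y.
Proof.
by apply/rowP => k; rewrite !mxE; apply: eq_bigr => j _; rewrite mxE [RHS]mulrC.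
Qed.

Section BaseChange.
Variables (R S : comNzRingType) (phi : {rmorphism R -> S}) (m : set R) (n : set S).
Hypotheses (locR : is_local_ring m) (locS : is_local_ring n).
Hypothesis (hphi : is_local_hom phi m n).
Variables (V : lmodType R) (f : {linear V -> restrict_scalars phi S^o}) (D : nat).
Hypotheses (f_surj : forall y, exists x, f x = y) (f_ladder : flat_ladder D f).

Let map_vmulE p q (x : 'rV[V]_p) (Y : 'M[R]_(p, q)) :
  (map_mx f (vmul x Y) : 'rV[S]_q) = (map_mx f x : 'rV[S]_p) *m map_mx phi Y.
Proof. by rewrite map_vmul vmul_restrict. Qed.

Let row_lift p (x : 'rV[S]_p) : exists y, (map_mx f y : 'rV[S]_p) = x.
Proof.
have /choice[g gP] := f_surj.
by exists (map_mx g x); apply/rowP => i; rewrite !mxE gP.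
Qed.

(** As [f] is onto, im f is S, and Tor over im f is Tor over S. *)
Lemma base_change_exact (c : nat -> nat) (b : forall k, 'M[R]_(c k.+1, c k)) k :
  (forall l, mxexact (b l.+1) (b l)) -> (D <= k)%N ->
  mxexact (map_mx phi (b k.+1)) (map_mx phi (b k)).
Proof.
move=> b_exact Dk x; split; last first.
  by case=> y ->; rewrite -mulmxA -map_mxM (mxexact0 (b_exact k)) map_mx0 mulmx0.
have [y <-] := row_lift x; rewrite -map_vmulE.
move/(flat_ladder_tor b_exact f_ladder Dk) => [z fz]; exists (map_mx f z).
rewrite -map_vmulE; apply/eqP; rewrite -subr_eq0; apply/eqP.
by rewrite -[RHS]fz map_mxB.
Qed.

Variables (c : nat -> nat) (A : forall t, 'M[R]_(c t.+1, c t)).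
Hypothesis A_exact : forall t, mxexact (A t.+1) (A t).
Variables (p : nat -> nat) (B : forall k, 'M[R]_(p k.+1, p k)).
Hypothesis B_exact : forall k, mxexact (B k.+1) (B k).
Variable j : nat.
Hypothesis torb : forall i (V W : lmodType R) (g : {linear V -> W}) t,
  flat_ladder i g -> (i <= D)%N -> tor_vanish (fun k => hom_b c B k t) g j.

Let noethR p' q (Y : 'M[R]_(p', q)) : exists r (X : 'M_(r, p')), mxexact X Y.
Proof. by apply: noetherian_mxexact; case: locR. Qed.

Let mapa k s : map_mx phi (hom_a A p k s) = lin_mulmx (map_mx phi (A s)).
Proof. by apply: map_lin_mx => M; rewrite map_mxM. Qed.

Let mapb k s : map_mx phi (hom_b c B k s) = lin_mulmxr (map_mx phi (B k)).
Proof. by apply: map_lin_mx => M; rewrite map_mxM. Qed.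

Lemma base_change_ext t : (forall s, (t <= s)%N -> mx_ext_vanish A (B j) s) ->
  mx_ext_vanish (fun s => map_mx phi (A s)) (map_mx phi (B j)) t.
Proof.
move=> extR F G FG.
have [x xF] := row_lift (mxvec F); have [y yG] := row_lift (mxvec G).
have ext s : (t <= s)%N -> ext_vanish_mx (hom_a A p) (hom_b c B) j s.
  by move=> ts; apply/ext_vanish_mxP; exact: extR.
have := flat_ladder_ext (hom_ab A B) (hom_aa A_exact p) (hom_bb c B_exact)
  noethR torb f_ladder (leqnn D) ext.
case/(_ x y).
  apply/eqP; rewrite map_mxB subr_eq0; apply/eqP.
  by rewrite !map_vmulE xF yG mapa mapb !mul_vec_lin /= FG.
move=> H [K /eqP]; rewrite !map_mxB -addrA -opprD subr_eq0 => /eqP.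
rewrite !map_vmulE xF mapa mapb.
move: (map_mx f H : 'rV[S]__) (map_mx f K : 'rV[S]__) => h k.
rewrite -[h]vec_mxK -[k]vec_mxK !mul_vec_lin -linearD => /(can_inj mxvecK) ->.
by exists (vec_mx h), (vec_mx k).
Qed.

(** Stacking [C] (coboundaries in terms of the generators [Zl]) on [Y] (relations among these) gives
    a presentation matrix of Ext^(t+1) over R. Vanishing over S makes its image left invertible, and
    Nakayama's lemma brings a left inverse back to R. *)
Lemma base_change_ext_descent t :
    (forall s, (t < s)%N -> mx_ext_vanish A (B j) s) ->
    mx_ext_vanish (fun s => map_mx phi (A s)) (map_mx phi (B j)) t ->
  mx_ext_vanish A (B j) t.
Proof.
move=> extR extS; apply/ext_vanish_mxP => F G FG.
have ext s : (t < s)%N -> ext_vanish_mx (hom_a A p) (hom_b c B) j s.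
  by move=> ts; apply/ext_vanish_mxP; exact: extR.
have [z [Zl [Zr ZP]]] := gens_exists (hom_a A p) (hom_b c B) noethR j t.
have [r [Y YZ]] := noethR Zl.
(* The rows of [Q] generate the coboundaries together with the multiples of [B]. *)
pose Q := col_mx (hom_a A p j t) (hom_b c B j t.+1).
have [C CQ] : exists C, Q = C *m Zl.
  have aZ : row_mx (hom_a A p j t) 0 *m
      col_mx (hom_a A p j t.+1) (- hom_b c B j t.+2) = 0.
    by rewrite mul_row_col mul0mx addr0; exact: hom_aa.
  have bZ : row_mx (hom_b c B j t.+1) (hom_a A p j.+1 t.+1) *m
      col_mx (hom_a A p j t.+1) (- hom_b c B j t.+2) = 0.
    by rewrite mul_row_col mulmxN hom_ab subrr.
  have [C1] := mxexact_lift ZP aZ; rewrite mul_mx_row => /eq_row_mx[C1P _].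
  have [C2] := mxexact_lift ZP bZ; rewrite mul_mx_row => /eq_row_mx[C2P _].
  by exists (col_mx C1 C2); rewrite mul_col_mx -C1P -C2P.
have [V' V'P] : exists V', map_mx phi Zl = V' *m map_mx phi Q.
  have /choice[v vP] i : exists v, row i (map_mx phi Zl) = v *m map_mx phi Q.
    have [H [K HK]] : exists H K, vec_mx (map_mx phi (row i Zl)) =
        map_mx phi (A t) *m H + K *m map_mx phi (B j).
      apply: (extS _ (vec_mx (map_mx phi (row i Zr)))).
      have := congr1 (row i) (cocycle_gens ZP); rewrite !row_mul => /(congr1 (map_mx phi)).
      rewrite !map_mxM mapa mapb.
      rewrite -{1}[map_mx phi (row i Zl)]vec_mxK -{1}[map_mx phi (row i Zr)]vec_mxK.
      by rewrite !mul_vec_lin => /(can_inj mxvecK).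
    exists (row_mx (mxvec H) (mxvec K)).
    rewrite map_col_mx mul_row_col mapa mapb !mul_vec_lin -linearD /= -HK vec_mxK.
    by rewrite map_row.
  by exists (\matrix_i v i); apply/row_matrixP => i; rewrite row_mul rowK.
(* [V'] expresses the cocycles over S by coboundaries, so [1 - V' *m map_mx phi C] consists of
   relations among the rows of the image of [Zl]. *)
have [W WP] : exists W, 1%:M - V' *m map_mx phi C = W *m map_mx phi Y.
  have /choice[w wP] i : exists w, row i (1%:M - V' *m map_mx phi C) = w *m map_mx phi Y.
    have [x xP] := row_lift (row i (1%:M - V' *m map_mx phi C)).
    have [||v fv] := cocycle_relations (hom_bb c B_exact) torb ZP (w := x) YZ
        f_ladder (leqnn D).
    - move=> i' V1 W1 g; exact: (flat_ladder_cocycle_lift (hom_ab A B)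
        (hom_aa A_exact p) (hom_bb c B_exact) noethR torb ZP ext).
    - rewrite map_vmulE xP -row_mul mulmxBl mul1mx -mulmxA -map_mxM -CQ -V'P.
      by rewrite subrr; exact: row0.
    exists (map_mx f v); rewrite -xP -map_vmulE; apply/eqP; rewrite -subr_eq0.
    by apply/eqP; rewrite -[RHS]fv map_mxB.
  by exists (\matrix_i w i); apply/row_matrixP => i; rewrite row_mul rowK.
have [|U UP] := local_left_inverse (phi := phi) (Q := col_mx C Y) (V := row_mx V' W)
    locR locS hphi.
  by rewrite map_col_mx mul_row_col -WP addrC subrK.
have ZlQ : Zl = lsubmx U *m Q.
  rewrite -[LHS]mul1mx -UP -[U]hsubmxK mul_row_col mulmxDl -!mulmxA -CQ.
  by rewrite (mxexact0 YZ) mulmx0 addr0 row_mxKl.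
have [w ->] := cocycle_gensP ZP FG.
exists (w *m lsubmx (lsubmx U)), (w *m rsubmx (lsubmx U)).
by rewrite -!mulmxA -mulmxDr -mul_row_col hsubmxK -ZlQ.
Qed.

End BaseChange.

(** * Dimension shifting and existence of free resolutions *)

Section DimensionShift.
Variables (R : comNzRingType) (n : nat -> nat) (A : forall t, 'M[R]_(n t.+1, n t)).
Hypothesis A_exact : forall t, mxexact (A t.+1) (A t).
Hypothesis dual_exact : forall t, mx_ext_vanish A (0 : 'M_(0, 1)) t.

Lemma dual_mxexact t q (F : 'M_(n t.+1, q)) :
  A t.+1 *m F = 0 -> exists H, F = A t *m H.
Proof.
move=> AF; have /choice[h hP] i : exists h, col i F = A t *m h.
  have [|H [K ->]] := dual_exact (F := col i F) (G := 0) (t := t).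
    by rewrite colE mulmxA AF !mul0mx.
  by exists H; rewrite mulmx0 addr0.
exists (\matrix_(k, i) h i k 0); apply/matrixP => k i.
have /colP/(_ k) := hP i; rewrite !mxE => ->.
by apply: eq_bigr => l _; rewrite mxE.
Qed.

(** From 0 -> coker A_(j+1) -> R^(n j) -> coker A_j -> 0, the middle term having no higher Ext by
    [dual_exact]. *)
Lemma mx_ext_vanish_shift j t :
  mx_ext_vanish A (A j) t <-> mx_ext_vanish A (A j.+1) t.+1.
Proof.
have AA s := mxexact0 (@A_exact s).
split=> ext F G FG.
  have [F' F'P] : exists F', F *m A j = A t.+1 *m F'.
    by apply: dual_mxexact; rewrite mulmxA FG -mulmxA AA mulmx0.
  have [H [K HK]] := ext _ _ (esym F'P).
  have [|L LP] := mxexact_lift (@A_exact j) (Z := F - A t.+1 *m K).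
    by rewrite mulmxBl F'P HK mulmxDr !mulmxA AA mul0mx add0r subrr.
  by exists K, L; rewrite -LP addrC subrK.
have [|G' G'P] := mxexact_lift (@A_exact j) (Z := A t.+2 *m G).
  by rewrite -mulmxA -FG mulmxA AA mul0mx.
have [H [K HK]] := ext _ _ G'P.
have [|L LP] := dual_mxexact (F := F - H *m A j) (t := t).
  by rewrite mulmxBr FG HK mulmxDl -!mulmxA AA mulmx0 addr0 subrr.
by exists L, H; rewrite -LP subrK.
Qed.

(** The right side amounts to Ext^(t+1) of the j-th syzygy against itself. *)
Lemma mx_ext_vanish_shiftn j t :
  mx_ext_vanish A (A 0) t <-> mx_ext_vanish A (A j) (t + j).
Proof.
elim: j => [|j IH]; first by rewrite addn0.
by rewrite addnS; apply: (iff_trans IH); exact: mx_ext_vanish_shift.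
Qed.

End DimensionShift.

Lemma free_resolution_exists (R : comNzRingType) (M : lmodType R) :
  noetherian R -> finitely_generated M ->
  exists (n : nat -> nat) (A : forall t, 'M[R]_(n t.+1, n t))
    (aug : {linear 'rV[R]_(n 0) -> M}),
  [/\ forall x, exists y, aug y = x,
      forall x, aug x = 0 <-> exists y, x = y *m A 0 &
      forall t, mxexact (A t.+1) (A t)].
Proof.
move=> noeth [n0 [v vP]].
have [] := noetherian_row_span (K := [set x | row_comb v x = 0]%classic) noeth.
- exact: linear0.
- by move=> x y /= x0 y0; rewrite linearD /= x0 y0 addr0.
- by move=> a x /= x0; rewrite linearZ /= x0 scaler0.
move=> n1 [A0 A0P].
(* The recursion runs on matrices paired with their sizes; the columns of each new matrix match the
   rows of the previous one by computation, so no casts arise. *)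
have ex (s : {pq : nat * nat & 'M[R]_(pq.1, pq.2)}) :
    exists X : {r & 'M[R]_(r, (tag s).1)}, mxexact (tagged X) (tagged s).
  by have [r [X XP]] := noetherian_mxexact (tagged s) noeth;
    exists (existT (fun r => 'M[R]_(r, (tag s).1)) r X).
pose next s := projT1 (cid (ex s)); have nextP s := projT2 (cid (ex s)).
pose c := fix c t : {pq : nat * nat & 'M[R]_(pq.1, pq.2)} :=
  if t is u.+1 then
    existT (fun pq : nat * nat => 'M[R]_(pq.1, pq.2))
      (tag (next (c u)), (tag (c u)).1) (tagged (next (c u)))
  else existT (fun pq : nat * nat => 'M[R]_(pq.1, pq.2)) (n1, n0) A0.
exists (fun t => (tag (c t)).2), (fun t => tagged (c t)), (row_comb v); split=> //.
- move=> x; have [a ->] := vP x; exists (\row_i a i).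
  by apply: eq_bigr => i _; rewrite mxE.
- move=> t; exact: nextP.
Qed.

Lemma descending_induction (P : nat -> Prop) N :
  (forall t, (N <= t)%N -> P t) -> (forall t, (forall s, (t < s)%N -> P s) -> P t) ->
  forall t, P t.
Proof.
move=> largeP step t.
have aux d : (d <= N)%N -> forall s, (N - d <= s)%N -> P s.
  elim: d => [_|d IH dN] s; first by rewrite subn0; exact: largeP.
  rewrite leq_eqVlt => /predU1P[<-|]; last first.
    by rewrite subnSK // => ?; apply: IH => //; exact: ltnW.
  by apply: step => u; rewrite subnSK // => ?; apply: IH => //; exact: ltnW.
by apply: (aux N) => //; rewrite subnn.
Qed.

(** * Transfer between R and S along one resolution *)

Section FiniteFlatDim.
Variables (R S : comNzRingType) (phi : {rmorphism R -> S}) (m : set R) (n : set S).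
Hypotheses (locR : is_local_ring m) (locS : is_local_ring n).
Hypothesis (hphi : is_local_hom phi m n).
Variables (V : lmodType R) (f : {linear V -> restrict_scalars phi S^o}) (D : nat).
Hypotheses (f_surj : forall y, exists x, f x = y) (f_ladder : flat_ladder D f).

Variables (c : nat -> nat) (A : forall t, 'M[R]_(c t.+1, c t)).
Hypothesis A_exact : forall t, mxexact (A t.+1) (A t).
Hypothesis dual_exact : forall t, mx_ext_vanish A (0 : 'M_(0, 1)) t.

Let phiA t := map_mx phi (A t).

Let torb_syzygy j : (D <= j)%N ->
  forall i (V W : lmodType R) (g : {linear V -> W}) t,
  flat_ladder i g -> (i <= D)%N -> tor_vanish (fun k => hom_b c A k t) g j.
Proof.
move=> Dj i V' W g t lad iD.
have b_exact k : mxexact (hom_b c A k.+1 t) (hom_b c A k t) by exact: lin_mulmxr_exact.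
exact: (flat_ladder_tor b_exact lad (leq_trans iD Dj)).
Qed.

(** The target is R resolved by itself: [p] is 1 in degree 0 and 0 above, so the Tor condition
    concerns empty rows and holds for j = 0. *)
Lemma phiA_dual_exact t : mx_ext_vanish phiA (0 : 'M_(0, 1)) t.
Proof.
pose p k : nat := (k == 0)%N; pose B k : 'M[R]_(p k.+1, p k) := 0.
have B_exact k : mxexact (B k.+1) (B k).
  move=> x; split=> _; last by rewrite mulmx0.
  by exists 0; rewrite mul0mx; exact: thinmx0.
have torb i (V' W : lmodType R) (g : {linear V' -> W}) s : flat_ladder i g ->
    (i <= D)%N -> tor_vanish (fun k => hom_b c B k s) g 0.
  move=> _ _ x _; exists 0; apply/rowP => -[k] kP.
  by exfalso; move: kP; rewrite muln0.
have := base_change_ext locR f_surj f_ladder A_exact B_exact torb (t := t).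
by rewrite map_mx0; apply => s _; exact: dual_exact.
Qed.

Lemma phiA_exact k : (D <= k)%N -> mxexact (phiA k.+1) (phiA k).
Proof. exact: (base_change_exact f_surj f_ladder A_exact). Qed.

Lemma phiA_ext j t : (D <= j)%N -> (forall s, (t <= s)%N -> mx_ext_vanish A (A j) s) ->
  mx_ext_vanish phiA (phiA j) t.
Proof.
move=> Dj; exact: (base_change_ext locR f_surj f_ladder A_exact A_exact (torb_syzygy Dj)).
Qed.

Lemma phiA_ext_descent j t : (D <= j)%N ->
    (forall s, (t < s)%N -> mx_ext_vanish A (A j) s) ->
  mx_ext_vanish phiA (phiA j) t -> mx_ext_vanish A (A j) t.
Proof.
move=> Dj; exact: (base_change_ext_descent locR locS hphi f_surj f_ladder A_exact
  A_exact (torb_syzygy Dj)).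
Qed.

(* By exactness, this kernel is the base change of the syzygy [coker (A D.+2)]. *)
Let N := kernel (mulmxr (phiA D) : {linear 'rV_(c D.+1) -> 'rV_(c D)}).

Let aug_cycle (x : 'rV_(c D.+2)) : mulmxr (phiA D) (mulmxr (phiA D.+1) x) = 0.
Proof. by apply/(phiA_exact (leqnn D)); exists x. Qed.

Let aug : {linear 'rV_(c D.+2) -> N} := to_kernel aug_cycle.

Let aug_surj x : exists y, aug y = x.
Proof.
have [y xy] := (phiA_exact (leqnn D) (val x)).1 (kernelP x).
by exists y; apply: val_inj; rewrite /= xy.
Qed.

Let aug_exact x : aug x = 0 <-> exists y, x = y *m phiA D.+2.
Proof.
have [ex1 ex2] := phiA_exact (leqnSn D) x; split=> [/(congr1 val) /= /ex1 //|].
by move/ex2 => x0; apply: val_inj.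
Qed.

Lemma syzygy_fg : finitely_generated N.
Proof.
exists (c D.+2), (fun i => aug (delta_mx 0 i)) => x.
have [y <-] := aug_surj x; exists (fun i => y 0 i).
exact: (linear_row_comb aug).
Qed.

Let syz_exact t : mxexact (phiA (t.+1 + D.+2)) (phiA (t + D.+2)).
Proof. by apply: phiA_exact; apply: leq_trans (leq_addl t D.+2); rewrite !leqW. Qed.

Lemma syzygy_Ext_ring t : Ext_eq0 N S^o t.+1.
Proof.
apply/(Ext_ring_mx (n := fun t => c (t + D.+2)) (A := fun t => phiA (t + D.+2))
  t aug_surj aug_exact syz_exact).
exact: phiA_dual_exact.
Qed.

Lemma syzygy_Ext t : Ext_eq0 N N t.+1 <-> mx_ext_vanish phiA (phiA D.+2) (t + D.+2).
Proof.
refine (@Ext_mx S N (fun t => c (t + D.+2)) (fun t => phiA (t + D.+2)) aug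
  aug_surj aug_exact syz_exact N _ _ aug (phiA D.+2) t aug_surj aug_exact).
Qed.

Lemma syzygy_SAC n0 : SAC S -> (forall t, (n0 <= t)%N -> mx_ext_vanish A (A 0) t) ->
  forall t, mx_ext_vanish A (A 0) t.
Proof.
move=> sac ext0.
have shift := mx_ext_vanish_shiftn A_exact dual_exact D.+2.
have large t : (n0 + D.+2 <= t)%N -> mx_ext_vanish A (A D.+2) t.
  move=> le_t; have D_t : (D.+2 <= t)%N by apply: leq_trans le_t; exact: leq_addl.
  by rewrite -(subnK D_t); apply/shift/ext0; rewrite leq_subRL // addnC.
have extS t : mx_ext_vanish phiA (phiA D.+2) (t + D.+2).
  apply/syzygy_Ext; apply: sac => //; first exact: syzygy_fg.
    by case=> // i _; exact: syzygy_Ext_ring.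
  (* Index t of [mx_ext_vanish] stands for Ext^(t+1), whence the bound n0 + 1. *)
  exists n0.+1 => -[] // i le_i; apply/syzygy_Ext; apply: phiA_ext => [|s le_s].
    by rewrite !leqW.
  by apply: large; apply: leq_trans le_s; rewrite leq_add2r.
apply: descending_induction ext0 _ => t IH; apply/shift.
apply: phiA_ext_descent (extS t) => [|s lt_s]; first by rewrite !leqW.
have D_s : (D.+2 <= s)%N by apply: leq_trans (ltnW lt_s); exact: leq_addl.
by rewrite -(subnK D_s); apply/shift/IH; rewrite ltn_subRL addnC.
Qed.

Lemma syzygy_ARC : ARC S -> (forall t, mx_ext_vanish A (A 0) t) ->
  mx_ext_vanish A (A 1) 0.
Proof.
move=> arc ext0.
have ext t : (D.+2 <= t)%N -> mx_ext_vanish A (A D.+2) t.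
  move=> D_t; rewrite -(subnK D_t).
  exact/(mx_ext_vanish_shiftn A_exact dual_exact).
(* Ext^1(M, Omega M) is shifted up until the target is a syzygy of order D + 2. *)
suff : mx_ext_vanish A (A D.+2) D.+1.
  elim: D.+1 => [//|k IH] extk; apply: IH.
  exact/(mx_ext_vanish_shift A_exact dual_exact).
apply: phiA_ext_descent => [||F G FG]; [by rewrite !leqW|exact: ext|].
have projN : projective N.
  apply: arc syzygy_fg _ => -[] // i _; apply/Ext_eq0_prod; split.
    apply/syzygy_Ext/phiA_ext => [|s le_s]; first by rewrite !leqW.
    by apply: ext (leq_trans _ le_s); exact: leq_addl.
  exact: syzygy_Ext_ring.
have [s sP] := projN _ _ aug idfun aug_surj.
(* The splitting as a matrix: [X] is the identity modulo ker aug, which gives [Y], and it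
   annihilates boundaries, so dual exactness gives [H]. *)
pose X := lin1_mx (s \o aug).
have augX x : aug (x *m X) = aug x by rewrite mul_rV_lin1 /= sP.
have [Y YP] : exists Y, 1%:M - X = Y *m phiA D.+2.
  apply: (mxexact_lift (phiA_exact (leqnSn D))).
  apply/row_matrixP => i; rewrite row0 rowE mulmxA mulmxBr mulmx1 mulmxBl.
  have := congr1 val (augX (delta_mx 0 i)); rewrite /= => ->.
  exact: subrr.
have [H HP] : exists H, X = phiA D.+1 *m H.
  apply: (dual_mxexact (A := phiA) phiA_dual_exact (t := D.+1)); rewrite -/(phiA D.+2).
  apply/row_matrixP => i; rewrite row_mul mul_rV_lin1 /= row0.
  have -> : aug (row i (phiA D.+2)) = 0.
    by apply/aug_exact; exists (delta_mx 0 i); rewrite rowE.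
  exact: linear0.
have FE : F = X *m F + (1%:M - X) *m F by rewrite -mulmxDl addrC subrK mul1mx.
by exists (H *m F), (Y *m G); rewrite [LHS]FE YP {1}HP -!mulmxA FG.
Qed.

End FiniteFlatDim.

(* The hypothesis lifts the identity: [A 0] is then von Neumann regular, so
   that its cokernel splits off. *)
Lemma coker_projective (R : comNzRingType) (M : lmodType R) (n : nat -> nat)
    (A : forall t, 'M[R]_(n t.+1, n t)) (aug : {linear 'rV[R]_(n 0) -> M}) :
    (forall x, exists y, aug y = x) ->
    (forall x, aug x = 0 <-> exists y, x = y *m A 0) ->
    mxexact (A 1) (A 0) -> mx_ext_vanish A (A 1) 0 ->
  projective M.
Proof.
move=> aug_surj aug_exact A_exact ext B C g f g_surj.
(* Multiplying 1 = A_0 H + K A_1 by A_0 on the right gives A_0 = A_0 H A_0. *)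
have [|H [K HK]] := ext 1%:M 1%:M; first by rewrite mulmx1 mul1mx.
have A0H : A 0 = A 0 *m H *m A 0.
  by rewrite -[LHS]mul1mx HK mulmxDl -[K *m _ *m _]mulmxA (mxexact0 A_exact) mulmx0 addr0.
(* [1 - H *m A 0] vanishes on the image of [A 0], so it factors through M as a section of [aug]. *)
have [x /aug_exact[y ->]|h hP] :=
    linear_factor aug_surj (u := mulmxr (1%:M - H *m A 0)).
  by rewrite /= -mulmxA mulmxBr mulmx1 mulmxA -A0H subrr mulmx0.
have [k kP] := free_projective (f \o aug) g_surj.
exists (k \o h) => x; have [y <-] := aug_surj x.
rewrite /= hP kP /= mulmxBr mulmx1 linearB mulmxA.
by have -> : aug (y *m H *m A 0) = 0; [apply/aug_exact; exists (y *m H)|rewrite subr0].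
Qed.

Theorem theorem1p3 (R S : comNzRingType) (m : set R) (n : set S)
    (phi : {rmorphism R -> S})
    (hR : is_local_ring m) (hS : is_local_ring n)
    (hphi : is_local_hom phi m n)
    (hfd : finite_flat_dim (restrict_scalars phi S^o)) :
  (SAC S -> SAC R) /\ (ARC S -> ARC R).
Proof.
(* The augmentation of the flat resolution serves as [f], with D = d + 1. *)
have [d [F [flF F0]]] := hfd; have lad := flat_ladder_aug flF F0.
have noeth : noetherian R by case: hR.
split=> [sac M fg extR [n0 extM]|arc M fg ext];
  have [c [A [aug [aug_surj aug_exact A_exact]]]] := free_resolution_exists noeth fg.
  have dual t : mx_ext_vanish A (0 : 'M_(0, 1)) t.
    by apply/(Ext_ring_mx t aug_surj aug_exact A_exact); exact: extR.
  have ext0P t := Ext_mx aug_surj aug_exact A_exact t aug_surj aug_exact.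
  case=> // i _; apply/ext0P.
  apply: (syzygy_SAC hR hS hphi (@res_aug_surj _ _ F) lad A_exact dual sac (n0 := n0)).
  by move=> t n0t; apply/ext0P/extM; exact: leqW.
have dual t : mx_ext_vanish A (0 : 'M_(0, 1)) t.
  apply/(Ext_ring_mx t aug_surj aug_exact A_exact).
  by have /Ext_eq0_prod[] := ext t.+1 isT.
apply: (coker_projective aug_surj aug_exact (A_exact 0%N)).
apply: (syzygy_ARC hR hS hphi (@res_aug_surj _ _ F) lad A_exact dual arc) => t.
apply/(Ext_mx aug_surj aug_exact A_exact t aug_surj aug_exact).
by have /Ext_eq0_prod[] := ext t.+1 isT.
Qed.
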